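(* A graph $G$ is dominating if and only if it satisfies one of the following three conditions: (1) $G$ contains a uniform subdivision of $T_\omega$ as a subgraph; (2) $G$ contains $\mathfrak{b}$ pairwise disjoint subgraphs, each of which is a subdivision of $T_\omega$; (3) $G$ contains $\mathfrak{d}$ pairwise disjoint rays.
   Context: For $f,g\colon\omega\to\omega$ write $g\le^* f$ (equivalently $f\ge^* g$; ''$f$ dominates $g$'') if $\{n\in\omega : f(n)<g(n)\}$ is finite. A family $\mathcal F$ of functions $\omega\to\omega$ is a dominating family if every $g\colon\omega\to\omega$ is dominated by some $f\in\mathcal F$; $\mathfrak d$ is the least cardinality of a dominating family. $\mathcal F$ is bounded if some $g\colon\omega\to\omega$ dominates every $f\in\mathcal F$, and unbounded otherwise; $\mathfrak b$ is the least cardinality of an unbounded family. A graph $G$ on a set $X$ (its vertex set, of arbitrary cardinality) is a set of unordered pairs of distinct elements of $X$ (its edges), i.e. $G\subseteq [X]^2$. A subgraph of $G$ is a graph on some $X'\subseteq X$ which is a subset of $G\cap[X']^2$. Graphs are disjoint if their vertex sets are disjoint. The degree of a vertex is the number of edges containing it. A ray in $G$ is a one-to-one function $R\colon\omega\to X$ such that $\{R(n-1),R(n)\}\in G$ for all $n>0$; two rays are disjoint if their images are disjoint. A finite path is defined in the same way with domain some $m\in\omega$, and $m$ is called its length. A graph $G$ on $X$ is dominating if there is a labelling $L\colon X\to\omega$ such that for every $f\colon\omega\to\omega$ there is a ray $R$ in $G$ with $f\le^* L\circ R$. A tree is a graph in which any two vertices are connected by a unique path (trees are taken to be nonempty). $T_\omega$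 is the tree in which every vertex has countably infinite degree. A tree $T$ is a subdivision of $T_\omega$ if each vertex of $T$ has either degree $2$ or countably infinite degree, and every ray in $T$ contains a vertex of infinite degree in $T$. The vertices of infinite degree are the branch vertices of $T$. A subdivided edge at a branch vertex $x$ is a path in $T$ joining $x$ to another branch vertex and containing no further branch vertices. A subdivision $T$ of $T_\omega$ is uniform if it has a branch vertex $r$ (the root) such that whenever $x$ is a branch vertex, all the subdivided edges at $x$ that are not contained in the unique path in $T$ from $x$ to $r$ have the same length. *)

(* Defs.v *)
From mathcomp Require Import all_boot.
From mathcomp Require Import boolp classical_sets functions cardinality.

Set Implicit Arguments.
Unset Strict Implicit.
Unset Printing Implicit Defensive.

Local Open Scope classical_set_scope.
Local Open Scope card_scope.

Definition dominates (f g : nat -> nat) : Prop :=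
  finite_set [set n | (f n < g n)%N].

Definition dominating_family (F : set (nat -> nat)) : Prop :=
  forall g : nat -> nat, exists2 f, F f & dominates f g.

Definition bounded_family (F : set (nat -> nat)) : Prop :=
  exists g : nat -> nat, forall f, F f -> dominates g f.

Definition unbounded_family (F : set (nat -> nat)) : Prop :=
  ~ bounded_family F.

Definition least_card (P : set (set (nat -> nat))) (F : set (nat -> nat)) :
    Prop :=
  P F /\ forall F' : set (nat -> nat), P F' -> F #<= F'.

(* The cardinals b and d are represented by the families that realise them:
   "b many objects" means objects indexed by some F with [has_card_b F]. *)
Definition has_card_b : set (nat -> nat) -> Prop :=
  least_card unbounded_family.

Definition has_card_d : set (nat -> nat) -> Prop :=
  least_card dominating_family.

(* The vertex set is a subset of an ambient type, so that a subgraph lives in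
   the same type; an edge is a two-element set of vertices. *)
Record graph (T : Type) := Graph {
  vertices : set T;
  edges : set (set T);
  edgesP : forall e, edges e ->
    exists x y, [/\ vertices x, vertices y, x <> y & e = [set x; y]]
}.

Section Graphs.
Variable T : Type.
Implicit Types (G H : graph T) (x y r : T) (p q R : nat -> T) (m k : nat).

Definition subgraph H G : Prop :=
  vertices H `<=` vertices G /\ edges H `<=` edges G.

Definition incident G x : set (set T) := [set e | edges G e /\ e x].

(* The common part of rays (D = setT) and of finite paths (D = `I_m); the
   values of R outside D are irrelevant. *)
Definition walk_on (D : set nat) G R : Prop :=
  [/\ forall n, D n -> vertices G (R n),
      set_inj D R &
      forall n, D n -> D n.+1 -> edges G [set R n; R n.+1]].

Definition ray G R : Prop := walk_on setT G R.

(* As the length of a path is the size of its domain, it counts vertices. *)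
Definition fpath G m p : Prop := walk_on `I_m G p.

Definition fpath_between G x y m p : Prop :=
  [/\ fpath G m p, (0 < m)%N, p 0%N = x & p m.-1 = y].

Definition dominating_graph G : Prop :=
  exists L : T -> nat, forall f : nat -> nat,
    exists2 R, ray G R & dominates (L \o R) f.

Definition tree G : Prop :=
  vertices G !=set0 /\
  forall x y, vertices G x -> vertices G y ->
    (exists m p, fpath_between G x y m p) /\
    (forall m p k q, fpath_between G x y m p -> fpath_between G x y k q ->
       m = k /\ forall n, (n < m)%N -> p n = q n).

Definition branch_vertex G x : Prop :=
  vertices G x /\ infinite_set (incident G x).

Definition subdivision_Tomega G : Prop :=
  [/\ tree G,
      forall x, vertices G x ->
        incident G x #= `I_2 \/ incident G x #= [set: nat] &
      forall R, ray G R -> exists n, branch_vertex G (R n)].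

Definition subdivided_edge G x m p : Prop :=
  exists y, [/\ branch_vertex G y, y <> x, fpath_between G x y m p &
    forall n, (n < m)%N -> branch_vertex G (p n) -> p n = x \/ p n = y].

Definition uniform_subdivision_Tomega G : Prop :=
  subdivision_Tomega G /\
  exists2 r, branch_vertex G r &
    forall x k q, branch_vertex G x -> fpath_between G x r k q ->
    forall m p m' p',
      subdivided_edge G x m p -> ~ (p @` `I_m `<=` q @` `I_k) ->
      subdivided_edge G x m' p' -> ~ (p' @` `I_m' `<=` q @` `I_k) ->
      m = m'.

End Graphs.

(* Main.v *)
Require Import Defs.
From mathcomp Require Import all_boot.
From mathcomp Require Import boolp classical_sets functions cardinality.
Import Defs.

Set Implicit Arguments.
Unset Strict Implicit.
Unset Printing Implicit Defensive.

Local Open Scope classical_set_scope.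

(** A graph with one of the three structures is dominating by an explicit
labelling.  Disjoint rays indexed by a dominating family D are labelled so that
the values along the ray of index i form the function i itself
([disjoint_rays_dominate]).  A subdivision of T_omega is walked through in
blocks, a block leading from a branch vertex to a next one: at each branch
vertex infinitely many numbered blocks leave the path walked so far, and all
new vertices of a block get a label depending on its number only
([block_structure]).  If the subdivision is uniform, the length of the next
block is known before its number n is chosen, so the label n works: n is chosen
above the values of f on the positions to come ([uniform_dominates]).  In
general the position where block n ends grows with n, but as there are only
countably many places to choose from, one function h eventually bounds all of
these positions.  Block n is given the label g(h(n+1)), where f, g and
h are taken increasing; whenever f(m) < g(m) for some m between h(n) and h(n+1), block n is
good for f, so that it suffices that f does not dominate g
([subdivision_dominates]).  Among b disjoint subdivisions, with g running
through an unbounded family, some g is as required.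

Conversely, let L be a labelling of a graph G with none of the three
structures.  The engine is a ranking of the vertices.  If every nonempty set Y
of vertices has an element that is separated from the rest of Y, then removing
the separated elements again and again exhausts all vertices, and the stage of
removal is a well-ordered rank such that each x is separated from the other
vertices of rank at least that of x ([ranking]).  If on the contrary no element
of some nonempty Y is separated from the rest of Y, a subdivision of T_omega
can be grown with all its branch vertices in Y, by always taking a new path
that avoids the finite tree built so far ([kernel_subdivision]).  As the
ranks are well-ordered, every ray has a tail along which each vertex x is followed by a
vertex of at least the same rank ([recurrent_tail]), and this path must meet
the separator of x.  This traps the ray in finite sets, at infinitely many
places called milestones.

- In a graph without a (countable) subdivision of T_omega, separation by one
  finite set is available.  The j-th milestone lies in a finite set determined
  by the first vertex u, so its label is at most some g_u(j), and it occurs at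
  position j or later ([milestone_bound_by_rank]).
- In a graph without a uniform subdivision only the paths of each fixed length
  can be cut by a finite set.  Still, for a given position p there are only
  finitely many candidates for a milestone at p, whence a bound g_u(p)
  ([milestone_bound_by_position]).

Let U be the union of a maximal family M of disjoint countable subdivisions.
If the functions g_u with u in U were unbounded, then M would have at least b
members; so a single f_1 dominates all of them, and no ray meeting U infinitely
often has labels above f_1.  The remaining rays may be taken in G - U, which
contains no subdivision.  Take a maximal family of disjoint rays there.  If the
functions g_u with u on these rays were dominating, the family would have at
least d members; so some f_2 is dominated by none of them.  Every ray of G - U
meets one of these rays at some vertex u, and the milestones from u on show
that its labels are not above f_2.  Hence no ray dominates f_1 and f_2
simultaneously, and G is not dominating by L ([dominating_graph_contains]). *)

(** * Maximal families, least cardinals and well-ordered rankings *)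

(** Zorn's lemma for families of pairwise compatible objects; it is used for
disjoint subdivisions, for disjoint rays, and for choice functions that differ
everywhere. *)
Lemma maximal_independent (I : Type) (Q : set I) (conflict : I -> I -> Prop) :
  exists M : set I,
    [/\ M `<=` Q, forall i j, M i -> M j -> i <> j -> ~ conflict i j &
        forall i, Q i -> ~ M i -> exists2 j, M j & conflict i j \/ conflict j i].
Proof.
pose P (M : set I) := M `<=` Q /\
  forall i j, M i -> M j -> i <> j -> ~ conflict i j.
have [F FP Ftot|M [[MQ Mi] Mmax]] := @Zorn_bigcup I P.
  split=> [i [X FX Xi]|i j [X FX Xi] [Y FY Yj]]; first by have [XQ _] := FP _ FX; exact: XQ.
  have [_ XI] := FP _ FX; have [_ YI] := FP _ FY.
  by have [XY|YX] := Ftot _ _ FX FY; [apply: YI => //; exact: XY|apply: XI => //; exact: YX].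
exists M; split=> // i Qi nMi; apply: contrapT => nc.
apply: (Mmax (M `|` [set i])); first by split=> [|sub]; [left|apply: nMi; apply: sub; right].
split=> [j [/MQ//|->//]|j k [Mj|->] [Mk|->] jk // c].
- exact: (Mi j k).
- by apply: nc; exists j => //; right.
- by apply: nc; exists k => //; left.
Qed.

Lemma card_le_inj (T U : Type) (A : set T) (B : set U) (u0 : U) :
  (A #<= B)%card -> exists2 f : T -> U, (forall x, A x -> B (f x)) &
    forall x y, A x -> A y -> f x = f y -> x = y.
Proof.
elim/Ppointed: U => U in B u0 *; first by case: (no u0).
move=> /pcard_leP/injfunPex[f fB finj]; exists f => // x y Ax Ay.
by apply: finj; exact/mem_set.
Qed.

(** Cardinals are well-ordered, without ordinals: among the choice functions on
the family P take a maximal set M of functions that pairwise differ at every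
member of P.  Evaluation at each member is injective on M, and at some member F
it is onto, since otherwise a new choice function could be picked outside all
the images.  Then F has the cardinality of M and embeds into every other
member. *)
Lemma least_card_exists (P : set (set (nat -> nat))) :
  P !=set0 -> exists F, least_card P F.
Proof.
move=> [F0 PF0].
pose Q (phi : set (nat -> nat) -> nat -> nat) := forall F, P F -> F (phi F).
have [M [MQ Mdiff Mmax]] := maximal_independent Q
  (fun phi psi => exists2 F, P F & phi F = psi F).
suff [F PF onto] : exists2 F, P F &
    forall x, F x -> exists2 phi, M phi & phi F = x.
  exists F; split=> // F' PF'.
  have [s sP] : {s : (nat -> nat) -> set (nat -> nat) -> nat -> nat &
      forall x, F x -> M (s x) /\ s x F = x}.
    apply: (@choice _ _ (fun x phi => F x -> M phi /\ phi F = x)) => x.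
    by have [/onto[phi]|nFx] := pselect (F x);
      [exists phi|exists (fun=> x)].
  have inj : set_inj F (fun x => s x F').
    move=> x y /set_mem Fx /set_mem Fy exy; have [Mx <-] := sP _ Fx.
    have [My <-] := sP _ Fy; apply: contrapT => nxy.
    by apply: (Mdiff (s x) (s y)) => // [e|]; [apply: nxy; rewrite e|exists F'].
  rewrite -(card_le_eql (inj_card_eq inj)); apply: subset_card_le.
  by move=> _ [x /sP[/MQ Qx _] <-]; exact: Qx.
apply: contrapT => no_onto.
have [phi phiP] : {phi : set (nat -> nat) -> nat -> nat & forall F, P F ->
    F (phi F) /\ forall psi, M psi -> psi F <> phi F}.
  apply: (@choice _ _ (fun F x =>
    P F -> F x /\ forall psi, M psi -> psi F <> x)) => F.
  have [PF|] := pselect (P F); last by exists id.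
  apply: contrapT => nex; apply: no_onto; exists F => // x Fx.
  apply: contrapT => nx; apply: nex; exists x => _; split=> // psi Mpsi e.
  by apply: nx; exists psi.
have Qphi : Q phi by move=> F /phiP[].
have nMphi : ~ M phi by move=> Mphi; have [_ /(_ _ Mphi)] := phiP _ PF0.
have [psi Mpsi [[F PF e]|[F PF e]]] := Mmax _ Qphi nMphi;
  by have [_ /(_ _ Mpsi)] := phiP _ PF; rewrite e.
Qed.


Section Ranking.
Variables (T : Type) (sep : T -> set T -> Prop).
Hypothesis sepE : forall Y : set T, Y !=set0 -> exists2 x, Y x & sep x Y.

Let D (Y : set T) := Y `&` [set x | ~ sep x Y].

(** The transfinite sequence obtained by iterating D and taking intersections at
limit stages, encoded as the family of its members. *)
Inductive derived : set T -> Prop :=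
| derived_step Y : derived Y -> derived (D Y)
| derived_bigcap (F : set (set T)) :
    (forall Y, F Y -> derived Y) -> derived (\bigcap_(Y in F) Y).

Let D_sub Y : D Y `<=` Y. Proof. by move=> x []. Qed.

Let extreme Y := forall Z, derived Z -> Y `<=` Z -> Y <> Z -> Y `<=` D Z.

Let extreme_cmp Y Z : extreme Y -> derived Z -> Z `<=` D Y \/ Y `<=` Z.
Proof.
move=> extY; elim=> {Z} [Z dZ [ZY|YZ]|F dF IH].
- by left=> x /D_sub/ZY.
- have [<-|nYZ] := pselect (Y = Z); first by left.
  by right; exact: extY.
- have [[Z FZ sub]|nex] := pselect (exists2 Z, F Z & Z `<=` D Y).
    by left=> x /(_ _ FZ)/sub.
  right=> x Yx Z FZ; have [sub|] := IH _ FZ; last exact.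
  by case: nex; exists Z.
Qed.

Let derived_extreme Y : derived Y -> extreme Y.
Proof.
elim=> {Y} [Y dY extY|F dF IH] Z dZ YZ nYZ.
  have [ZY|{}YZ] := extreme_cmp extY dZ; first by case: nYZ; apply/seteqP.
  have [<-//|neq] := pselect (Y = Z).
  by move=> x /D_sub; exact: (extY Z).
(* Otherwise Z is below the intersection, hence equal to it. *)
have [Y FY nZY] : exists2 Y, F Y & ~ Z `<=` Y.
  apply: contrapT => nex; case: nYZ; apply/seteqP; split=> // x Zx Y FY.
  by apply: contrapT => nYx; case: nex; exists Y => // /(_ _ Zx).
have [ZY|{}YZ'] := extreme_cmp (IH _ FY) dZ; first by case: nZY => x /ZY/D_sub.
move=> x /(_ _ FY); apply: (IH _ FY) => // eYZ.
by apply: nZY; rewrite eYZ.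
Qed.

(** The rank of x is the stage of the sequence at which x disappears, and
le x y says that y survives at least as long as x.  A set is covered by a
smallest stage C; an element of it outside D C has least rank.  The last
property holds since the vertices of rank at least that of x form a stage C
that contains x while D C does not. *)
Lemma ranking : exists le : T -> T -> Prop,
  [/\ forall x y z, le x y -> le y z -> le x z,
      forall x y, le x y \/ le y x,
      forall Y : set T, Y !=set0 -> exists2 x, Y x & forall y, Y y -> le x y &
      forall x, sep x [set y | le x y]].
Proof.
exists (fun x y => forall Y, derived Y -> Y x -> Y y); split.
- by move=> x y z xy yz Y dY /(xy _ dY)/(yz _ dY).
- move=> x y; have [|/existsNP[Y /not_implyP[dY /not_implyP[Yx nYy]]]] :=
    pselect (forall Y, derived Y -> Y x -> Y y); first by left.
  right=> Z dZ Zy; have [ZY|] := extreme_cmp (derived_extreme dY) dZ; last exact.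
  by case: nYy; apply: D_sub; exact: ZY.
- move=> Y [y0 Yy0]; pose C := \bigcap_(K in [set K | derived K /\ Y `<=` K]) K.
  have YC : Y `<=` C by move=> y Yy K [_]; exact.
  have dC : derived C by apply: derived_bigcap => K [].
  have [x Yx nDx] : exists2 x, Y x & ~ D C x.
    apply: contrapT => nex; have YD : Y `<=` D C.
      by move=> x Yx; apply: contrapT => nDx; apply: nex; exists x.
    have [|x Cx sx] := @sepE C; first by exists y0; exact: YC.
    by have [] : D C x by apply: Cx; split=> //; exact: derived_step.
  exists x => // y Yy K dK Kx.
  have [KC|] := extreme_cmp (derived_extreme dC) dK; last by apply; exact: YC.
  by case: nDx; exact: KC.
- move=> x; pose C := \bigcap_(K in [set K | derived K /\ K x]) K.
  have -> : [set y | forall Y, derived Y -> Y x -> Y y] = C.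
    by apply/seteqP; split=> y /= Cy K; [case|move=> dK Kx]; exact: Cy.
  have dC : derived C by apply: derived_bigcap => K [].
  have Cx : C x by move=> K [].
  apply: contrapT => nsx; have [y Cy sy] : exists2 y, C y & sep y C.
    by apply: sepE; exists x.
  have [_ //] : D C y by apply: Cy; split; [exact: derived_step|].
Qed.
End Ranking.

(** Recursion in which the n-th choice may depend on all earlier ones; Q is
stated for total sequences, of which only the first n values matter. *)
Lemma history_choice (X : Type) (Q : nat -> (nat -> X) -> X -> Prop) (x0 : X) :
  (forall n h h' x, (forall k, k < n -> h k = h' k) -> Q n h x -> Q n h' x) ->
  (forall n h, (forall k, k < n -> Q k h (h k)) -> exists x, Q n h x) ->
  exists w, forall n, Q n w (w n).
Proof.
move=> Qext Qex.
have [nx nxP] : {nx : nat * (nat -> X) -> X &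
    forall nh, (exists x, Q nh.1 nh.2 x) -> Q nh.1 nh.2 (nx nh)}.
  apply: (@choice _ _ (fun nh y => (exists x, Q nh.1 nh.2 x) -> Q nh.1 nh.2 y)).
  by move=> nh; have [[x Qx]|] := pselect (exists x, Q nh.1 nh.2 x);
    [exists x|exists x0].
pose l := fix l n : seq X :=
  if n is m.+1 then rcons (l m) (nx (m, nth x0 (l m))) else [::].
have sl n : size (l n) = n by elim: n => //= n IH; rewrite size_rcons IH.
pose w n := nth x0 (l n.+1) n.
have lw m k : k < m -> nth x0 (l m) k = w k.
  elim: m => // m IH; rewrite ltnS leq_eqVlt => /orP[/eqP->//|km].
  by rewrite /= nth_rcons sl km IH.
exists w => n; elim/ltn_ind: n => n IH.
rewrite {2}/w /= nth_rcons sl ltnn eqxx.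
apply: (Qext _ _ _ _ (lw n)); apply: (nxP (n, nth x0 (l n))) => /=.
apply: Qex => k kn; rewrite (lw _ _ kn).
by apply: Qext (IH _ kn) => j jk; rewrite lw // (ltn_trans jk).
Qed.

(** * Eventual domination *)

Lemma dominatesP f g :
  dominates f g <-> exists N, forall n, N <= n -> g n <= f n.
Proof.
split=> [/finite_seqP[s sE]|[N fg]]; last first.
  apply: sub_finite_set (finite_II N) => n /= fgn.
  by rewrite ltnNge; apply/negP => /fg; rewrite leqNgt fgn.
exists (\max_(i <- s) i).+1 => n ltn; rewrite leqNgt; apply/negP => fgn.
have : n \in s by have : [set n | f n < g n] n by []; rewrite sE.
by move=> /(@leq_bigmax_seq _ _ xpredT id n)/(_ isT); rewrite leqNgt ltn.
Qed.

Lemma finite_set_bound (T : Type) (F : set T) (L : T -> nat) :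
  finite_set F -> exists N, forall x, F x -> L x <= N.
Proof.
move=> /(finite_image L)/finite_seqP[s sE]; exists (\max_(i <- s) i) => x Fx.
by apply: (@leq_bigmax_seq _ _ xpredT id (L x)) => //; have : (L @` F) (L x) by []; rewrite sE.
Qed.

(** The n-th value of the bound only has to beat the finitely many functions
with number at most n. *)
Lemma countable_bounded (I : Type) (U : set I) (g : I -> nat -> nat) :
  countable U -> exists h, forall u, U u -> dominates h (g u).
Proof.
move=> /countable_injP[c cinj].
pose V n := [set u | U u /\ c u <= n].
have Vfin n : finite_set (V n).
  have cV : {in V n &, injective c}.
    by move=> x y /set_mem[Ux _] /set_mem[Uy _]; apply: cinj; exact/mem_set.
  rewrite -(eq_finite_set (inj_card_eq cV)).
  by apply: sub_finite_set (finite_II n.+1) => _ [x [_ xn] <-]; rewrite /= ltnS.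
have [h hP] : {h : nat -> nat & forall n u, V n u -> g u n <= h n}.
  apply: (@choice _ _ (fun n m => forall u, V n u -> g u n <= m)) => n.
  exact: (finite_set_bound (g^~ n)).
by exists h => u Uu; apply/dominatesP; exists (c u) => n cn; apply: hP.
Qed.

Definition monotone_hull (f : nat -> nat) n := \max_(i < n.+1) f i.

Lemma monotone_hull_ge f i n : i <= n -> f i <= monotone_hull f n.
Proof.
by rewrite -ltnS => i_n; exact: (@leq_bigmax _ (fun k : 'I_n.+1 => f k) (Ordinal i_n)).
Qed.

Lemma monotone_hull_mono f m n :
  m <= n -> monotone_hull f m <= monotone_hull f n.
Proof.
move=> mn; apply/bigmax_leqP => -[i im] _ /=; apply: monotone_hull_ge.
by rewrite -ltnS (leq_trans im).
Qed.

Lemma dominates_trans f g h : dominates f g -> dominates g h -> dominates f h.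
Proof.
move=> /dominatesP[N fg] /dominatesP[M gh]; apply/dominatesP.
exists (maxn N M) => n; rewrite geq_max => /andP[Nn Mn].
exact: leq_trans (gh _ Mn) (fg _ Nn).
Qed.

Lemma not_dominates_often f g : ~ dominates f g ->
  forall M, exists2 m, M <= m & f m < g m.
Proof.
move=> nfg M; apply: contrapT => nex; apply: nfg; apply/dominatesP; exists M => m Mm.
by rewrite leqNgt; apply/negP => lt; apply: nex; exists m.
Qed.

(** * Walks and finite separation *)

Lemma walk_onP (T : Type) (G : graph T) (D : set nat) R :
  walk_on D G R <->
  [/\ forall n, D n -> vertices G (R n),
      forall i j, D i -> D j -> R i = R j -> i = j &
      forall n, D n -> D n.+1 -> edges G [set R n; R n.+1]].
Proof.
split=> -[RV Rinj RE]; split=> // i j.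
  by move=> Di Dj; apply: Rinj; apply/mem_set.
by move=> /set_mem Di /set_mem Dj; exact: Rinj.
Qed.

Section Walks.
Variables (T : Type) (G : graph T).
Implicit Types (p R : nat -> T).

Lemma ray_shift k R : ray G R -> ray G (fun n => R (k + n)).
Proof.
move=> /walk_onP[RV Rinj RE]; apply/walk_onP; split=> [n _|i j _ _ /Rinj e|n _ _].
- exact: RV.
- by apply/eqP; rewrite -(eqn_add2l k); apply/eqP; exact: e.
- by rewrite addnS; exact: RE.
Qed.

Lemma ray_fpath m R : ray G R -> fpath G m R.
Proof.
move=> /walk_onP[RV Rinj RE]; apply/walk_onP; split=> [n _|i j _ _|n _ _].
- exact: RV.
- exact: Rinj.
- exact: RE.
Qed.

Lemma fpath_shift j k m p :
  j + k <= m -> fpath G m p -> fpath G k (fun n => p (j + n)).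
Proof.
move=> jkm /walk_onP[pV pinj pE].
have lt n : n < k -> j + n < m by move=> nk; rewrite (leq_trans _ jkm) // ltn_add2l.
apply/walk_onP; split=> [n /= /lt|i i' /= /lt ik /lt i'k e|n /= /lt nk].
- exact: pV.
- by apply/eqP; rewrite -(eqn_add2l j); apply/eqP; exact: pinj.
- by rewrite addnS => /lt; rewrite addnS => n1k; exact: pE.
Qed.

Lemma fpath_prefix k m p : k <= m -> fpath G m p -> fpath G k p.
Proof.
move=> km /walk_onP[pV pinj pE].
have lt n : n < k -> n < m by move=> nk; exact: leq_trans km.
apply/walk_onP; split=> [n /= /lt|i j /= /lt ik /lt jk|n /= /lt nk /lt n1k].
- exact: pV.
- exact: pinj.
- exact: pE.
Qed.

End Walks.

(** The restriction to lengths in K covers two needs: with K the whole set the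
separator F cuts all paths from x to other vertices of Y, and with K a singleton
it cuts those of a single length. *)
Definition separated (T : Type) (G : graph T) (K : set nat) (x : T) (Y : set T) :=
  exists F : set T, [/\ finite_set F, ~ F x &
    forall k p, K k -> 0 < k -> fpath G k.+1 p -> p 0 = x -> Y (p k) ->
      exists2 j, j <= k & F (p j)].

(** * Milestones along a ray *)

Section Milestones.
Variables (T : Type) (G : graph T) (L : T -> nat) (le : T -> T -> Prop).
Hypothesis le_trans : forall x y z, le x y -> le y z -> le x z.
Hypothesis le_total : forall x y, le x y \/ le y x.
Hypothesis le_least :
  forall Y : set T, Y !=set0 -> exists2 x, Y x & forall y, Y y -> le x y.
Implicit Types (p R : nat -> T).

Definition recurrent R := forall m, exists2 m', m < m' & le (R m) (R m').

(** Otherwise infinitely many vertices of the ray would have larger rank than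
everything after them; one of least rank among these contradicts the next. *)
Lemma recurrent_tail R :
  exists n0, forall n, n0 <= n -> recurrent (fun i => R (n + i)).
Proof.
apply: contrapT => nrec.
pose Y := [set x | exists2 m, R m = x & forall m', m < m' -> ~ le x (R m')].
have YE n0 : exists2 m, n0 <= m & Y (R m).
  apply: contrapT => nY; apply: nrec; exists n0 => n n0n i.
  apply: contrapT => nex; apply: nY; exists (n + i).
    by rewrite (leq_trans n0n) ?leq_addr.
  exists (n + i) => // m' lt lem; apply: nex; exists (m' - n).
    by rewrite ltn_subRL.
  by rewrite subnKC // ltnW // (leq_ltn_trans _ lt) // leq_addr.
have [|x [m Rm later] least] := @le_least Y.
  by have [m _ Ym] := YE 0; exists (R m).
by have [m' mm' /least] := YE m.+1; exact: later.
Qed.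

(** The next milestone after x is a vertex where the ray meets the separator
S x on its way to a vertex of rank at least that of x.  So the j-th milestone
belongs to the j-th level M j of a finitely branching tree. *)
Lemma milestone_bound_by_rank u :
  (forall x, separated G setT x [set y | le x y]) ->
  exists g : nat -> nat, forall R, ray G R -> R 0 = u -> recurrent R ->
    forall j, exists2 p, j <= p & L (R p) <= g j.
Proof.
move=> sep.
have [S SP] := @choice _ _ (fun x F => [/\ finite_set F, ~ F x &
  forall k p, setT k -> 0 < k -> fpath G k.+1 p -> p 0 = x -> le x (p k) ->
    exists2 j, j <= k & F (p j)]) sep.
pose M := fix M j := if j is i.+1 then \bigcup_(x in M i) S x else [set u].
have Mfin j : finite_set (M j).
  elim: j => [|j IH]; first exact: finite_set1.
  by apply: bigcup_finite => // x _; have [] := SP x.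
have [g gP] := @choice _ _ (fun j N => forall x, M j x -> L x <= N)
  (fun j => finite_set_bound L (Mfin j)).
exists g => R rayR R0 recR j.
suff [p jp Mp] : exists2 p, j <= p & M j (R p) by exists p => //; exact: gP.
elim: j => [|j [p jp Mp]]; first by exists 0.
have [m pm le_pm] := recR p; have [Sfin nS Shit] := SP (R p).
have [|||||i ile Si] := Shit (m - p) (fun n => R (p + n)).
- by [].
- by rewrite subn_gt0.
- exact/ray_fpath/ray_shift.
- by rewrite addn0.
- by rewrite subnKC // ltnW.
exists (p + i); last by exists (R p).
case: i Si {ile} => [|i _]; first by rewrite addn0.
by rewrite addnS ltnS (leq_trans jp) ?leq_addr.
Qed.

(** With z of rank at most a, these are the vertices where a path from z can
climb back to rank at least a for the first time, after k steps. *)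
Definition first_returns a z k := [set y | exists p,
  [/\ fpath G k.+1 p, p 0 = z, p k = y, le a y &
      forall j, 0 < j -> j < k -> ~ le a (p j)]].

(** A separator for z and the length k is hit by the path.  Hit at the end, the
end is in the finite separator; hit before, at a vertex of rank below a, the rest
of the path is a shorter first return to a starting in the separator. *)
Lemma first_returns_finite a z k :
  (forall x k, separated G [set k] x [set y | le x y]) ->
  le z a -> finite_set (first_returns a z k).
Proof.
move=> sep; elim/ltn_ind: k z => k IH z za.
case: k IH => [|k] IH.
  by apply: sub_finite_set (finite_set1 z) => y [p [_ <- <-]].
have [F [Ffin nFz Fhit]] := sep z k.+1.
pose B := \bigcup_(j in `I_k.+1 `&` [set j | 0 < j])
  \bigcup_(z' in F `&` [set z' | le z' a]) first_returns a z' (k.+1 - j).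
have Bfin : finite_set B.
  apply: bigcup_finite => [|j [/= jk j0]]; first exact/finite_setIl/finite_II.
  apply: bigcup_finite => [|z' [_ z'a]]; first exact: finite_setIl.
  by apply: IH z'a; rewrite ltn_subrL j0.
have FBfin : finite_set (F `|` B) by rewrite finite_setU.
apply: sub_finite_set FBfin => _ [p [pP p0 <- ay pj]].
have [|j jk Fj] := Fhit k.+1 p erefl isT pP p0; first exact: le_trans ay.
have j0 : 0 < j by case: j Fj {jk} => //; rewrite p0.
move: jk; rewrite leq_eqVlt => /orP[/eqP <-|jk]; first by left.
right; exists j => //; exists (p j).
  split=> //=; have [|//] := le_total a (p j).
  by move=> /(pj _ j0 jk).
exists (fun n => p (j + n)); split.
- by apply: fpath_shift pP; rewrite addnS subnKC // ltnW.
- by rewrite addn0.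
- by rewrite subnKC // ltnW.
- by [].
- by move=> i i0 ik; apply: pj; rewrite ?ltn_addr // -ltn_subRL.
Qed.

(** Milestones are first returns here, and not vertices of the separators:
the separator depends on the length of the path, which is not known when it is
hit early.  The index is the position on the ray. *)
Inductive milestone_at u : nat -> T -> Prop :=
| milestone_start : milestone_at u 0 u
| milestone_next q x k y : milestone_at u q x -> 0 < k ->
    first_returns x x k y -> milestone_at u (q + k) y.

Lemma milestone_bound_by_position u :
  (forall x k, separated G [set k] x [set y | le x y]) ->
  exists g : nat -> nat, forall R, ray G R -> R 0 = u -> recurrent R ->
    forall N, exists2 p, N <= p & L (R p) <= g p.
Proof.
move=> sep; have le_refl x : le x x by have [] := le_total x x.
have Mfin q : finite_set (milestone_at u q).
  elim/ltn_ind: q => q IH.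
  pose B := \bigcup_(i in `I_q) \bigcup_(x in milestone_at u i)
    first_returns x x (q - i).
  have Bfin : finite_set B.
    apply: bigcup_finite => [|i /= iq]; first exact: finite_II.
    apply: bigcup_finite => [|x _]; first exact: IH.
    exact: first_returns_finite.
  have uB : finite_set ([set u] `|` B).
    by rewrite finite_setU; split=> //; exact: finite_set1.
  apply: sub_finite_set uB => y My.
  case def_q: _ _ / My => [|i x k z Mx k0 yP]; first by left.
  right; exists i; first by rewrite /= def_q -{1}[i]addn0 ltn_add2l.
  by exists x => //; rewrite def_q addKn.
have [g gP] := @choice _ _ (fun q N => forall x, milestone_at u q x -> L x <= N)
  (fun q => finite_set_bound L (Mfin q)).
exists g => R rayR R0 recR N.
suff [p Np Mp] : exists2 p, N <= p & milestone_at u p (R p).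
  by exists p => //; exact: gP.
elim: N => [|N [p Np Mp]]; first by exists 0 => //; rewrite R0; constructor.
have ex : exists m, (p < m) && `[< le (R p) (R m) >].
  by have [m pm le_pm] := recR p; exists m; rewrite pm; exact/asboolP.
case: (ex_minnP ex) => [m /andP[pm /asboolP le_pm] min_m].
exists m; first exact: leq_ltn_trans pm.
rewrite -(subnKC (ltnW pm)); apply: (milestone_next Mp); first by rewrite subn_gt0.
exists (fun n => R (p + n)); split=> //.
- exact/ray_fpath/ray_shift.
- by rewrite addn0.
- by rewrite subnKC // ltnW.
move=> j j0 jm le_pj; have : m <= p + j.
  by apply: min_m; rewrite -[p.+1]addn1 leq_add2l j0; exact/asboolP.
by rewrite leqNgt -ltn_subRL jm.
Qed.

End Milestones.

(** * Pairs, and operations on finite paths *)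

Lemma set2_eq (T : Type) (x y v w : T) :
  [set x; y] = [set v; w] -> (x = v /\ y = w) \/ (x = w /\ y = v).
Proof.
move=> e; have [xv|xw] : [set v; w] x by rewrite -e; left.
  have [yv|yw] : [set v; w] y by rewrite -e; right.
    have [wx|wy] : [set x; y] w by rewrite e; right.
      by left; rewrite wx -xv yv.
    by left; rewrite wy.
  by left.
have [yv|yw] : [set v; w] y by rewrite -e; right.
  by right.
have [vx|vy] : [set x; y] v by rewrite e; left.
  by right; rewrite vx yw.
by right; rewrite vy.
Qed.

Lemma card_pair (T : Type) (A : set T) :
  (A #= `I_2)%card <-> exists x y, x <> y /\ A = [set x; y].
Proof.
split=> [/eq_cardSP[x Ax /eq_cardSP[y [Ay nyx]]]|[x [y [nxy ->]]]].
  rewrite II0 card_eq0 => /eqP e0; exists x, y; split=> [exy|]; first exact: nyx.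
  apply/seteqP; split=> z; last by case=> ->.
  move=> Az; apply: contrapT => /not_orP[nzx nzy].
  by have : set0 z by rewrite -e0.
apply/eq_cardSP; exists x; first by left.
have -> : [set x; y] `\ x = [set y].
  apply/seteqP; split=> z; first by case=> -[].
  by move=> ->; split; [right|move=> e; apply: nxy].
exact: card_set1.
Qed.

Definition cons_walk (T : Type) (x : T) (p : nat -> T) n :=
  if n is k.+1 then p k else x.

Section PathOperations.
Variables (T : Type) (G : graph T).
Implicit Types (x y : T) (p q : nat -> T).

Lemma fpath_cons m p x : vertices G x -> fpath G m p ->
  (0 < m -> edges G [set x; p 0]) -> (forall i, i < m -> p i <> x) ->
  fpath G m.+1 (cons_walk x p).
Proof.
move=> Gx /walk_onP[pV pinj pE] xE nx; apply/walk_onP; split.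
- by case=> //= n; exact: pV.
- move=> [|i] [|j] //= im jm e.
  + by case: (nx j).
  + by case: (nx i).
  + by rewrite (pinj _ _ im jm e).
- case=> [_ m1|n nm n1m] /=; [exact: xE|exact: pE].
Qed.

Lemma fpath_between_rev x y m p :
  fpath_between G x y m p -> fpath_between G y x m (fun n => p (m.-1 - n)).
Proof.
case=> /walk_onP[pV pinj pE] m0 p0 pm; split=> //; last by rewrite subnn.
  have lt n : m.-1 - n < m by rewrite (leq_ltn_trans (leq_subr _ _)) // prednK.
  apply/walk_onP; split=> [n _|i j /= im jm e|n /= nm n1m].
  - exact/pV/lt.
  - have := pinj _ _ (lt i) (lt j) e.
    move=> /(congr1 (fun k => m.-1 - k)).
    by rewrite !subKn // -ltnS prednK.
  - have e : m.-1 - n = (m.-1 - n.+1).+1.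
      by rewrite -subSn ?subSS // -ltnS prednK.
    have := pE (m.-1 - n.+1) (lt _); rewrite -e => /(_ (lt n)).
    by rewrite setUC.
by rewrite subn0.
Qed.

End PathOperations.

(** * Trees given by a parent function *)

Section ParentTree.
Variables (T : Type) (V : set T) (r : T) (par : T -> T) (d : T -> nat).
Hypothesis Vr : V r.
Hypothesis V_par : forall v, V v -> v <> r -> V (par v) /\ d (par v) < d v.

Definition parent_edges := [set e | exists v, [/\ V v, v <> r & e = [set v; par v]]].

Lemma parent_edgesP e : parent_edges e ->
  exists x y, [/\ V x, V y, x <> y & e = [set x; y]].
Proof.
move=> [v [Vv nv ->]]; exists v, (par v); have [Vp lt] := V_par Vv nv.
by split=> // e1; move: lt; rewrite -e1 ltnn.
Qed.

Definition parent_graph : graph T := Graph parent_edgesP.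
Let H := parent_graph.

Lemma parent_graph_adj x y : edges H [set x; y] ->
  (V x /\ x <> r /\ y = par x) \/ (V y /\ y <> r /\ x = par y).
Proof.
by case=> v [Vv nv e]; case: (set2_eq e) => -[-> ->]; [left|right].
Qed.

(** below a is the set of descendants of a, the subtree hanging at a. *)
Inductive below (a : T) : T -> Prop :=
| below_refl : below a a
| below_child y : V y -> y <> r -> below a (par y) -> below a y.

Lemma below_depth a y : below a y -> y = a \/ d a < d y.
Proof.
elim=> {y} [|y Vy nr _ [e|lt]]; first by left.
  by right; rewrite -e; have [] := V_par Vy nr.
by right; apply: ltn_trans lt _; have [] := V_par Vy nr.
Qed.

Lemma below_par a : V a -> a <> r -> ~ below a (par a).
Proof.
move=> Va nr; have [_ lt] := V_par Va nr.
by move=> /below_depth[e|lt']; [move: lt; rewrite e ltnn|move: (ltn_trans lt lt'); rewrite ltnn].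
Qed.

Lemma below_inv a y : below a y -> y = a \/ below a (par y).
Proof. by case=> [|z _ _ az]; [left|right]. Qed.

Lemma below_linear a b y : below a y -> below b y -> below a b \/ below b a.
Proof.
elim=> {y} [|y Vy nr ay IH] yb; first by right.
have [<-|{}yb] := below_inv yb; last exact: IH.
by left; exact: below_child.
Qed.

(** The subtree at v is joined to the rest of the tree by the edge from v to its
parent only. *)
Lemma leave_subtree v m p : fpath H m.+1 p -> below v (p 0) -> ~ below v (p m) ->
  exists2 i, i < m & p i = v /\ p i.+1 = par v.
Proof.
move=> /walk_onP[_ _ pE] b0; elim: m pE => [//|m IH] pE nbm.
have [bm|nb] := pselect (below v (p m)); last first.
  have [|i im e] := IH _ nb; last by exists i => //; rewrite ltnS ltnW.
  by move=> n /= nm n1m; apply: pE; rewrite /= ltnW.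
exists m => //; have /parent_graph_adj[[Vm [nr e]]|[Vm [nr e]]] :
  edges H [set p m; p m.+1] by apply: pE => /=.
  have [pv|] := below_inv bm; first by rewrite e pv.
  by rewrite -e.
by case: nbm; apply: below_child; rewrite -?e.
Qed.

Lemma enter_subtree v m p : fpath H m.+1 p -> ~ below v (p 0) -> below v (p m) ->
  exists2 i, i < m & p i.+1 = v.
Proof.
move=> pP nb0 bm.
have pB : fpath_between H (p 0) (p m) m.+1 p by split.
have [qP _ q0 qm] := fpath_between_rev pB.
have [||i im [e _]] := leave_subtree (v := v) qP; rewrite /= ?subn0 ?subnn //.
exists (m - i).-1; first by rewrite prednK ?subn_gt0 // leq_subr.
by rewrite prednK ?subn_gt0.
Qed.

(** Coming back below x would use the edge from par x to x once more and visit x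
twice. *)
Lemma first_step_up m p x : fpath H m.+2 p -> p 0 = x -> V x -> x <> r ->
  p 1 = par x -> ~ below x (p m.+1).
Proof.
move=> pP p0 Vx nr p1 bx.
have [|||i im e] := enter_subtree (v := x) (fpath_shift (j := 1) (k := m.+1) _ pP);
  rewrite ?addn0 ?add1n ?p1 //; first exact: below_par.
have /walk_onP[_ pinj _] := pP.
by have := pinj i.+2 0; rewrite p0 -[i.+2]add1n e => /(_ im isT erefl).
Qed.

Lemma first_step_down m p x : fpath H m.+2 p -> p 0 = x -> V (p 1) -> p 1 <> r ->
  x = par (p 1) -> below (p 1) (p m.+1).
Proof.
move=> pP p0 Vx nr p1; apply: contrapT => nb.
have [|||i im [_ e]] := leave_subtree (v := p 1) (fpath_shift (j := 1) (k := m.+1) _ pP);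
  rewrite ?addn0 ?add1n //; first exact: below_refl.
have /walk_onP[_ pinj _] := pP.
by have := pinj i.+2 0; rewrite p0 -[i.+2]add1n e => /(_ im isT (esym p1)).
Qed.

(** Deleting the first edge of a path splits the tree into two sides, and the end
of the path is on the far side; this determines the edge, since the subtrees at
two children of a vertex are disjoint. *)
Lemma first_step_unique m k p q : fpath H m.+2 p -> fpath H k.+2 q ->
  p 0 = q 0 -> p m.+1 = q k.+1 -> p 1 = q 1.
Proof.
move=> pP qP e0 elast.
have /walk_onP[_ _ pE] := pP; have /walk_onP[_ _ qE] := qP.
have /parent_graph_adj[[Vx [nr px]]|[Vp [nr px]]] : edges H [set p 0; p 1] by exact: pE.
  have nb := first_step_up pP erefl Vx nr px.
  have /parent_graph_adj[[_ [_ qx]]|[Vq [nr' qx]]] : edges H [set q 0; q 1] by exact: qE.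
    by rewrite px qx e0.
  have := first_step_down qP erefl Vq nr' qx.
  rewrite -elast => bq; case: nb; elim: bq => [|z Vz nz _]; last exact: below_child.
  by apply: below_child => //; rewrite -qx e0; exact: below_refl.
have bp := first_step_down pP erefl Vp nr px.
have /parent_graph_adj[[Vx [nr' qx]]|[Vq [nr' qx]]] : edges H [set q 0; q 1] by exact: qE.
  have := first_step_up qP erefl Vx nr' qx; rewrite -elast; case.
  elim: bp => [|z Vz nz _]; last exact: below_child.
  by apply: below_child => //; rewrite -px e0; exact: below_refl.
have bq := first_step_down qP erefl Vq nr' qx; rewrite -elast in bq.
suff sib a b : V a -> a <> r -> par a = par b -> below a b -> a = b.
  have [bb|bb] := below_linear bp bq; last first.
    by apply/esym; apply: sib => //; rewrite -px -qx.
  by apply: sib => //; rewrite -px -qx.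
move=> Va na e ab; have [//|] := below_inv ab.
by rewrite -e => /(below_par Va na).
Qed.

Lemma root_depth y : V y -> y = r \/ d r < d y.
Proof.
move: {2}(d y).+1 (leqnn (d y).+1) => n; elim: n y => // n IH y yn Vy.
have [|nr] := pselect (y = r); first by left.
have [Vp lt] := V_par Vy nr; right.
by have [|<-//|lt'] := IH (par y) _ Vp; [exact: leq_trans lt yn|exact: ltn_trans lt].
Qed.

Lemma parent_graph_unique x y m p k q :
  fpath_between H x y m p -> fpath_between H x y k q ->
  m = k /\ forall n, n < m -> p n = q n.
Proof.
elim: m x p k q => [|m IH] x p k q; first by case.
case=> pP _ p0 pm [qP k0 q0 qk].
case: k qP k0 qk => // k qP _ /= qk; move: pm => /= pm.
have /walk_onP[_ pinj _] := pP; have /walk_onP[_ qinj _] := qP.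
case: m IH pP pm pinj => [|m] IH pP pm pinj.
  case: k qP qk qinj => [|k] qP qk qinj.
    by split=> // -[|//] _; rewrite p0 q0.
  by have := qinj 0 k.+1 isT (ltnSn _); rewrite q0 qk -p0 pm => /(_ erefl).
case: k qP qk qinj => [|k] qP qk qinj.
  by have := pinj 0 m.+1 isT (ltnSn _); rewrite p0 pm -q0 qk => /(_ erefl).
have e0 : p 0 = q 0 by rewrite p0 q0.
have e1 : p 1 = q 1 by apply: (first_step_unique pP qP); rewrite ?pm ?qk.
have [||[->] pq] := IH (p 1) (fun n => p (1 + n)) k.+1 (fun n => q (1 + n)).
- by split=> //; exact: fpath_shift pP.
- by split=> //; exact: fpath_shift qP.
by split=> // -[//|n]; rewrite ltnS => /pq.
Qed.

(** Induction on the total depth, replacing the deeper end by its parent.  The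
bound on the depths inside the path guarantees that this end is not met again. *)
Lemma parent_graph_connected x y : V x -> V y -> exists m p,
  fpath_between H x y m p /\
  forall i, i < m -> p i = x \/ p i = y \/ d (p i) < maxn (d x) (d y).
Proof.
move: {2}(d x + d y).+1 (ltnSn (d x + d y)) => n.
elim: n x y => // n IH x y; wlog yx : x y / d y <= d x => [wl|] xyn Vx Vy.
  have /orP[yx|yx] := leq_total (d y) (d x); first exact: wl.
  have [||||m [p [pP pd]]] := wl y x => //; first by rewrite addnC.
  exists m, (fun n => p (m.-1 - n)); split; first exact: fpath_between_rev.
  move=> i im; rewrite maxnC.
  have [|->|[->|]] := pd (m.-1 - i); [|by right; left|by left|by right; right].
  by rewrite (leq_ltn_trans (leq_subr _ _)) // prednK // (leq_ltn_trans _ im).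
have [exy|nxy] := pselect (x = y).
  exists 1, (fun=> x); split; last by move=> i _; left.
  split=> //; apply/walk_onP; split=> // [[|i]] [|j] //.
have nr : x <> r.
  move=> xr; have [yr|] := root_depth Vy; first by apply: nxy; rewrite yr.
  by rewrite -xr ltnNge yx.
have [Vp lt] := V_par Vx nr.
have [|m [p [[pP m0 p0 pm] pd]]] := IH (par x) y _ Vp Vy.
  by rewrite -ltnS; apply: leq_trans xyn; rewrite ltnS ltn_add2r.
have npx i : i < m -> p i <> x.
  move=> im; have [->|[->|lti]] := pd _ im; last 1 first.
  - by move=> e; move: lti; rewrite e ltnNge geq_max yx ltnW.
  - by move=> e; move: lt; rewrite e ltnn.
  - by move=> e; apply: nxy.
exists m.+1, (cons_walk x p); split; last first.
  move=> [|i] /=; first by left.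
  rewrite ltnS => /pd[->|[->|lti]]; right; last 1 first.
  - right; apply: leq_trans lti _; rewrite geq_max leq_maxr andbT.
    by rewrite leq_max ltnW.
  - by right; rewrite leq_max lt.
  - by left.
split=> //; last by case: m m0 pm {pd npx pP}.
apply: fpath_cons => //.
by move=> _; rewrite p0; exists x.
Qed.

Lemma parent_graph_tree : tree H.
Proof.
split; first by exists r.
move=> x y Vx Vy; split.
  by have [m [p [pP _]]] := parent_graph_connected Vx Vy; exists m, p.
by move=> m p k q; exact: parent_graph_unique.
Qed.

End ParentTree.

(** * Degrees in a subdivision *)

Lemma infinite_of_inj (U : Type) (A : set U) (f : nat -> U) :
  (forall n, A (f n)) -> injective f -> infinite_set A.
Proof.
move=> Af finj; apply: (@sub_infinite_set _ (range f)); first by move=> _ [n _ <-].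
have rf : (range f #= [set: nat])%card by apply: inj_card_eq => x y _ _; exact: finj.
by move=> fin; apply: infinite_nat; rewrite -(eq_finite_set rf).
Qed.

Lemma pair_third (U : Type) (A : set U) a b c : (A #= `I_2)%card ->
  A a -> A b -> A c -> a <> b -> a <> c -> b = c.
Proof.
move=> /card_pair[x [y [nxy ->]]].
by move=> [->|->] [->|->] [->|->] nb nc.
Qed.

Lemma degree_two (T : Type) (H : graph T) x : subdivision_Tomega H ->
  vertices H x -> ~ branch_vertex H x -> (incident H x #= `I_2)%card.
Proof.
move=> [_ deg _] Hx nb; have [//|inf] := deg _ Hx; case: nb; split=> // fin.
by apply: infinite_nat; rewrite -(eq_finite_set inf).
Qed.

(** At a vertex of degree two a path has no choice; so two paths with the same
first edge agree as long as no branch vertex is passed. *)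
Lemma paths_follow (T : Type) (H : graph T) m k p q : subdivision_Tomega H ->
  fpath H m p -> fpath H k q -> p 0 = q 0 -> p 1 = q 1 ->
  (forall i, 0 < i -> i.+1 < m -> ~ branch_vertex H (p i)) ->
  forall i, i < m -> i < k -> p i = q i.
Proof.
move=> sub /walk_onP[pV pinj pE] /walk_onP[qV qinj qE] e0 e1 nb.
suff pq i : (i < m -> i < k -> p i = q i) /\ (i.+1 < m -> i.+1 < k -> p i.+1 = q i.+1).
  by move=> i; have [] := pq i.
elim: i => [|i [IH IH1]]; first by split.
split=> // i2m i2k.
have i1m := ltnW i2m; have i1k := ltnW i2k; have im := ltnW i1m; have ik := ltnW i1k.
have {}IH := IH im ik; have {}IH1 := IH1 i1m i1k.
have deg : (incident H (p i.+1) #= `I_2)%card.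
  by apply: degree_two => //; [exact: pV|exact: nb].
have e : [set p i.+1; p i.+2] = [set p i.+1; q i.+2].
  apply: (@pair_third _ _ [set p i.+1; p i] _ _ deg).
  - by split; [rewrite setUC; exact: pE|left].
  - by split; [exact: pE|left].
  - by split; [rewrite IH1; exact: qE|left].
  - move=> ee; case: (set2_eq ee) => -[ei ei']; first by have := pinj _ _ im i2m ei'; move/eqP; rewrite ltn_eqF.
    by have := pinj _ _ i1m i2m ei; move/eqP; rewrite ltn_eqF.
  - rewrite IH IH1; move=> ee; case: (set2_eq ee) => -[ei ei'].
      by have := qinj _ _ ik i2k ei'; move/eqP; rewrite ltn_eqF.
    by have := qinj _ _ i1k i2k ei; move/eqP; rewrite ltn_eqF.
by case: (set2_eq e) => -[ei ei']; rewrite ei'.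
Qed.

(** Since the first vertex x is exempted, F may contain it. *)
Lemma not_separated_path (T : Type) (G : graph T) K x Y F :
  ~ separated G K x Y -> finite_set F ->
  exists k p, [/\ K k /\ 0 < k, fpath G k.+1 p, p 0 = x, Y (p k) &
    forall i, 0 < i -> i <= k -> ~ F (p i)].
Proof.
move=> nsep Ffin; apply: contrapT => nex; apply: nsep.
exists (F `\ x); split; [exact: finite_setD|by move=> [_]; exact|].
move=> k p Kk k0 pP p0 Yk; apply: contrapT => nhit; apply: nex; exists k, p.
split=> // i i0 ik Fi; apply: nhit; exists i => //; split=> // pix.
have /walk_onP[_ pinj _] := pP.
by have := pinj i 0 ik isT; rewrite p0 => /(_ pix) e; move: i0; rewrite e.
Qed.

(** * A subdivision grown inside an inseparable set *)

Lemma leq_sum_prefix (F : nat -> nat) m n :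
  m <= n -> \sum_(i < m) F i <= \sum_(i < n) F i.
Proof. by move=> /subnKC <-; rewrite big_split_ord leq_addr. Qed.

Section KernelTree.
Variables (T : Type) (G : graph T) (Y : set T) (K : T -> set nat) (b0 : T).
Hypothesis Yb0 : Y b0.
Hypothesis kernelY : forall x, Y x -> ~ separated G (K x) x Y.

(** The growing tree is recorded by a sequence of paths w n, each with its
length: path n starts at an older branch vertex and ends at the branch vertex of
index n.+1; the root b0 has index 0. *)
Definition branch_of (w : nat -> (nat -> T) * nat) j :=
  if j is i.+1 then (w i).1 (w i).2 else b0.

(** The index of the branch vertex where path n is attached.  Each index must be
used infinitely often, and only once that vertex exists; the 2-adic valuation of
n.+1 does both. *)
Definition source n := logn 2 n.+1.

Lemma source_le n : source n <= n.
Proof. by rewrite -ltnS ltn_logl. Qed.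

Lemma source_onto j : exists2 s : nat -> nat, injective s & forall t, source (s t) = j.
Proof.
(* The numbers n for which n.+1 is an odd multiple of 2 ^ j. *)
exists (fun t => (2 ^ j * t.*2.+1).-1) => [t t' e|t].
  have pos u : 0 < 2 ^ j * u.*2.+1 by rewrite muln_gt0 expn_gt0.
  have := congr1 succn e; rewrite !prednK // => /eqP.
  by rewrite eqn_pmul2l ?expn_gt0 // => /eqP[] /double_inj.
rewrite /source prednK ?muln_gt0 ?expn_gt0 // lognM ?expn_gt0 // pfactorK //.
by rewrite lognE /= dvdn2 /= odd_double /= addn0.
Qed.

(** Every new path leaves its source without meeting the finite tree built so
far: its source is not separated by that tree from the rest of Y. *)
Lemma kernel_paths : exists w : nat -> (nat -> T) * nat, forall n,
  [/\ K (branch_of w (source n)) (w n).2 /\ 0 < (w n).2,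
      fpath G (w n).2.+1 (w n).1, (w n).1 0 = branch_of w (source n),
      Y ((w n).1 (w n).2) &
      forall i, 0 < i -> i <= (w n).2 -> (w n).1 i <> b0 /\
        forall m j, m < n -> j <= (w m).2 -> (w n).1 i <> (w m).1 j].
Proof.
pose Q n (w : nat -> (nat -> T) * nat) (x : (nat -> T) * nat) :=
  [/\ K (branch_of w (source n)) x.2 /\ 0 < x.2,
      fpath G x.2.+1 x.1, x.1 0 = branch_of w (source n), Y (x.1 x.2) &
      forall i, 0 < i -> i <= x.2 -> x.1 i <> b0 /\
        forall m j, m < n -> j <= (w m).2 -> x.1 i <> (w m).1 j].
apply: (@history_choice _ Q (fun=> b0, 0)) => [n h h' x hh'|n h Qh].
  have -> : Q n h' x = Q n h x.
    have eb : branch_of h' (source n) = branch_of h (source n).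
      by case: (source n) (source_le n) => //= i lt; rewrite hh'.
    rewrite /Q eb; congr and5; apply: eq_forall => i; apply: eq_forall => _.
    apply: eq_forall => _; congr and; apply: eq_forall => m; apply: eq_forall => j.
    by apply/propext; split=> H mn; move: (H mn); rewrite hh'.
  by [].
have Yb : Y (branch_of h (source n)).
  case: (source n) (source_le n) => //= i lt.
  by have [] := Qh i lt.
pose F := [set b0] `|` \bigcup_(m in `I_n) ((h m).1 @` `I_(h m).2.+1).
have Ffin : finite_set F.
  rewrite finite_setU; split; first exact: finite_set1.
  by apply: bigcup_finite => [|m _]; [|apply: finite_image]; exact: finite_II.
have [k [p [Kk pP p0 Yk pF]]] := not_separated_path (kernelY Yb) Ffin.
exists (p, k); split=> //= i i0 ik; have nF := pF i i0 ik; split.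
  by move=> e; apply: nF; left.
by move=> m j mn jm e; apply: nF; right; exists m => //; exists j.
Qed.

Section Assembly.
Variable w' : nat -> (nat -> T) * nat.
Let w n := (w' n).1.
Let len n := (w' n).2.
Let b := branch_of w'.
Hypothesis len_gt0 : forall n, 0 < len n.
Hypothesis wP : forall n, fpath G (len n).+1 (w n).
Hypothesis w0 : forall n, w n 0 = b (source n).
Hypothesis w_new : forall n i, 0 < i -> i <= len n -> w n i <> b0 /\
  forall m j, m < n -> j <= len m -> w n i <> w m j.

Lemma new_vertex_inj n m i j : 0 < i -> i <= len n -> 0 < j -> j <= len m ->
  w n i = w m j -> n = m /\ i = j.
Proof.
move=> i0 ilen j0 jlen e; have [lt|lt|enm] := ltngtP n m.
- by have [_ /(_ n i lt ilen)] := w_new j0 jlen; rewrite e.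
- by have [_ /(_ m j lt jlen)] := w_new i0 ilen.
split=> //; subst m; have /walk_onP[_ inj _] := wP n.
exact: inj.
Qed.

Definition tree_vertices := [set v | v = b0 \/ exists n i, i < len n /\ v = w n i.+1].
Let V := tree_vertices.

Lemma inner_neq_branch_of n i : 0 < i -> i < len n -> forall j, w n i <> b j.
Proof.
move=> i0 ilen [|j] /=; first by have [] := w_new i0 (ltnW ilen).
move=> /(new_vertex_inj i0 (ltnW ilen) (len_gt0 j) (leqnn _))[enj eij].
by move: ilen; rewrite eij enj ltnn.
Qed.

Lemma branch_of_inj i j : b i = b j -> i = j.
Proof.
case: i => [|i]; case: j => [|j] //= e.
- by have [/(_ (esym e))] := w_new (len_gt0 j) (leqnn _).
- by have [/(_ e)] := w_new (len_gt0 i) (leqnn _).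
- by have [->] := new_vertex_inj (len_gt0 i) (leqnn _) (len_gt0 j) (leqnn _) e.
Qed.

Lemma branch_of_vertex j : V (b j).
Proof.
case: j => [|j]; first by left.
by right; exists j, (len j).-1; rewrite prednK // leqnn.
Qed.

Lemma path_vertex n i : i <= len n -> V (w n i).
Proof.
case: i => [|i] ilen; first by rewrite w0; exact: branch_of_vertex.
by right; exists n, i.
Qed.

(** Vertices are numbered in the order of their creation, which serves as the
depth; the parent of a vertex is its predecessor on the path that created it. *)
Lemma parent_data : exists (par : T -> T) (d : T -> nat),
  d b0 = 0 /\ forall n i, i < len n ->
    par (w n i.+1) = w n i /\ d (w n i.+1) = \sum_(m < n) len m + i.+1.
Proof.
have [|pd pdP] := @choice T (T * nat) (fun v yd => (v = b0 -> yd.2 = 0) /\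
  forall n i, i < len n -> v = w n i.+1 -> yd = (w n i, \sum_(m < n) len m + i.+1)).
  move=> v; have [->|nb] := pselect (v = b0).
    exists (b0, 0); split=> // n i ilen e.
    by have [/(_ (esym e))] := w_new (ltn0Sn i) ilen.
  have [[n [i [ilen ->]]]|nex] := pselect (exists n i, i < len n /\ v = w n i.+1).
    exists (w n i, \sum_(m < n) len m + i.+1); split.
      by move=> e; have [/(_ e)] := w_new (ltn0Sn i) ilen.
    by move=> n' i' ilen' /new_vertex_inj[]// -> [->].
  by exists (b0, 0); split=> // n i ilen e; case: nex; exists n, i.
exists (fun v => (pd v).1), (fun v => (pd v).2); split.
  by have [->] := pdP b0.
by move=> n i ilen; have [_ /(_ n i ilen erefl)->] := pdP (w n i.+1).
Qed.

Variables (par : T -> T) (d : T -> nat).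
Hypothesis d_root : d b0 = 0.
Hypothesis par_w : forall n i, i < len n ->
  par (w n i.+1) = w n i /\ d (w n i.+1) = \sum_(m < n) len m + i.+1.

Lemma depth_branch_of j : d (b j) = \sum_(m < j) len m.
Proof.
case: j => [|j]; first by rewrite big_ord0.
have le : (len j).-1 < len j by rewrite prednK.
by rewrite big_ord_recr; have [_] := par_w le; rewrite prednK.
Qed.

Lemma depth_path_step n i : i < len n -> d (w n i) < d (w n i.+1).
Proof.
move=> ilen; have [_ ->] := par_w ilen; case: i ilen => [|i] ilen.
  rewrite w0 depth_branch_of addn1 ltnS.
  exact/leq_sum_prefix/source_le.
by have [_ ->] := par_w (ltnW ilen); rewrite ltn_add2l.
Qed.

Lemma tree_parent v : V v -> v <> b0 -> V (par v) /\ d (par v) < d v.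
Proof.
case=> [//|[n [i [ilen ->]]]] _; have [-> _] := par_w ilen.
by split; [apply: path_vertex; exact: ltnW|exact: depth_path_step].
Qed.

Let H := parent_graph tree_parent.

Lemma path_adjacent n i : i < len n -> edges H [set w n i; w n i.+1].
Proof.
move=> ilen; exists (w n i.+1); split; first exact: path_vertex.
  by have [] := w_new (ltn0Sn i) ilen.
by have [-> _] := par_w ilen; rewrite setUC.
Qed.

Lemma path_fpath n : fpath H (len n).+1 (w n).
Proof.
have /walk_onP[_ inj _] := wP n.
apply/walk_onP; split=> // i /= ilen; first exact: path_vertex.
by move=> i1; exact: path_adjacent.
Qed.

Lemma adjacent_on_path x y : edges H [set x; y] -> exists n i, i < len n /\
  ((x = w n i /\ y = w n i.+1) \/ (x = w n i.+1 /\ y = w n i)).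
Proof.
move=> adj; case: (parent_graph_adj adj) => -[Vx [nb e]].
  case: Vx => [//|[n [i [ilen ex]]]]; exists n, i; split=> //; right.
  by have [p _] := par_w ilen; rewrite e ex p.
case: Vx => [//|[n [i [ilen ey]]]]; exists n, i; split=> //; left.
by have [p _] := par_w ilen; rewrite e ey p.
Qed.

Lemma tree_vertex_cases v : V v ->
  (exists j, v = b j) \/ exists n i, [/\ 0 < i, i < len n & v = w n i].
Proof.
case=> [->|[n [i [ilen ->]]]]; first by left; exists 0.
move: ilen; rewrite leq_eqVlt => /orP[/eqP e|lt]; first by left; exists n.+1; rewrite e.
by right; exists n, i.+1.
Qed.

(** The first edges of the infinitely many paths attached at b j are distinct. *)
Lemma branch_of_branch_vertex j : branch_vertex H (b j).
Proof.
split; first exact: branch_of_vertex.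
have [s sinj sj] := source_onto j.
apply: (@infinite_of_inj _ _ (fun t => [set w (s t) 0; w (s t) 1])) => [t|t t'].
  by split; [exact: path_adjacent|left; rewrite w0 sj].
have wsb u k : w (s u) 1 = b k -> exists2 i, k = i.+1 & s u = i.
  case: k => [e|i e]; first by have [/(_ e)] := w_new (ltn0Sn 0) (len_gt0 (s u)).
  by exists i => //; have [] := new_vertex_inj (ltn0Sn 0) (len_gt0 _) (len_gt0 i) (leqnn _) e.
have ltsj u k : w (s u) 1 = b k -> j < k.
  move=> /wsb[i -> <-]; rewrite ltnS -{1}(sj u); exact: source_le.
move=> ee; case: (set2_eq ee) => -[e0 e1].
  by have [/sinj] := new_vertex_inj (ltn0Sn 0) (len_gt0 _) (ltn0Sn 0) (len_gt0 _) e1.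
by move: e1; rewrite w0 sj => /ltsj; rewrite ltnn.
Qed.

Lemma inner_incident n i : 0 < i -> i < len n ->
  incident H (w n i) = [set [set w n i; w n i.-1]; [set w n i; w n i.+1]].
Proof.
case: i => // i _ ilen; apply/seteqP; split=> e; last first.
  case=> ->; split; try by left.
    by rewrite setUC; apply: path_adjacent; exact: ltnW.
  exact: path_adjacent.
move=> [He ex]; have [x [y [_ _ _ exy]]] := edgesP He.
wlog xw : x y exy / x = w n i.+1 => [wl|].
  have [exw|eyw] : [set x; y] (w n i.+1) by rewrite -exy.
    exact: (wl x y exy (esym exw)).
  by apply: (wl y x _ (esym eyw)); rewrite exy setUC.
move: He; rewrite exy xw => adj; have [m [k [klen [[e1 e2]|[e1 e2]]]]] := adjacent_on_path adj.
- case: k klen e1 e2 => [|k] klen e1 e2.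
    by move: e1; rewrite w0 => /(inner_neq_branch_of (ltn0Sn i) ilen).
  have [en [ei]] := new_vertex_inj (ltn0Sn i) (ltnW ilen) (ltn0Sn k) (ltnW klen) e1.
  by right; rewrite e2 -en -ei.
- have [en [ei]] := new_vertex_inj (ltn0Sn i) (ltnW ilen) (ltn0Sn k) klen e1.
  by left; rewrite e2 -en -ei.
Qed.

Lemma inner_degree n i : 0 < i -> i < len n -> (incident H (w n i) #= `I_2)%card.
Proof.
move=> i0 ilen; rewrite inner_incident //; apply/card_pair.
exists [set w n i; w n i.-1], [set w n i; w n i.+1]; split=> // ee.
have /walk_onP[_ inj _] := wP n.
have i1 : i.-1 < (len n).+1 by rewrite (leq_ltn_trans (leq_pred _)) // ltnS ltnW.
have ii : i < (len n).+1 by rewrite ltnS ltnW.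
case: (set2_eq ee) => -[e1 e2].
  have := inj _ _ i1 (_ : i.+1 < (len n).+1) e2; rewrite ltnS => /(_ ilen).
  by case: i i0 {ilen ee i1 ii e1 e2} => // i _ /= /eqP; rewrite ltn_eqF.
have := inj _ _ ii (_ : i.+1 < (len n).+1) e1; rewrite ltnS => /(_ ilen)/eqP.
by rewrite ltn_eqF.
Qed.

Lemma tree_vertices_countable : countable V.
Proof.
pose code (o : option (nat * nat)) := if o is Some ni then w ni.1 ni.2 else b0.
apply: (@sub_countable _ _ _ (range code)).
  apply: subset_card_le => v [->|[n [i [ilen ->]]]]; first by exists None.
  by exists (Some (n, i.+1)).
exact: sub_countable (card_image_le _ _) (countableP _).
Qed.

Lemma branch_vertexP x : branch_vertex H x <-> exists j, x = b j.
Proof.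
split=> [[Hx inf]|[j ->]]; last exact: branch_of_branch_vertex.
have [//|[n [i [i0 ilen ex]]]] := tree_vertex_cases Hx.
by case: inf; rewrite ex; apply/finite_setP; exists 2; exact: inner_degree.
Qed.

Lemma inner_not_branch_vertex n i : 0 < i -> i < len n -> ~ branch_vertex H (w n i).
Proof. by move=> i0 ilen /branch_vertexP[j]; exact: inner_neq_branch_of. Qed.

(** A ray without branch vertices could not leave the path w m0 on which it
starts, but that path is finite. *)
Lemma tree_subdivision : subdivision_Tomega H.
Proof.
have tH : tree H by apply: parent_graph_tree; left.
split=> // [x Hx|R /walk_onP[RV Rinj RE]].
  have [[j ->]|[n [i [i0 ilen ->]]]] := tree_vertex_cases Hx; last by left; exact: inner_degree.
  right; have [_ inf] := branch_of_branch_vertex j; apply: eq_card_nat => //.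
  apply: (@sub_countable _ _ _ ((fun xy => [set xy.1; xy.2]) @` (V `*` V))).
    apply: subset_card_le => e [/edgesP[y [z [Vy Vz _ ->]]] _].
    by exists (y, z).
  apply: sub_countable (card_image_le _ _) _.
  exact: countableX tree_vertices_countable tree_vertices_countable.
apply: contrapT => nbr.
have inner n : exists m i, [/\ 0 < i, i < len m & R n = w m i].
  have [[j e]|//] := tree_vertex_cases (RV n I).
  by case: nbr; exists n; rewrite e; exact: branch_of_branch_vertex.
have [m0 [i0 [i0_gt0 i0len e0]]] := inner 0.
have stay n : exists i, [/\ 0 < i, i < len m0 & R n = w m0 i].
  elim: n => [|n [i [i_gt0 ilen e]]]; first by exists i0.
  have [m1 [i1 [i1_gt0 i1len e1]]] := inner n.+1.
  exists i1; suff -> : m0 = m1 by [].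
  have [m [k [klen [[ea eb]|[ea eb]]]]] := adjacent_on_path (RE n I I).
  - case: k klen ea eb => [|k] klen ea eb.
      by move: ea; rewrite e w0 => /(inner_neq_branch_of i_gt0 ilen).
    have [-> _] := new_vertex_inj i_gt0 (ltnW ilen) (ltn0Sn k) (ltnW klen) (etrans (esym e) ea).
    by have [-> _] := new_vertex_inj i1_gt0 (ltnW i1len) (ltn0Sn _) klen (etrans (esym e1) eb).
  - case: k klen ea eb => [|k] klen ea eb.
      by move: eb; rewrite e1 w0 => /(inner_neq_branch_of i1_gt0 i1len).
    have [-> _] := new_vertex_inj i_gt0 (ltnW ilen) (ltn0Sn _) klen (etrans (esym e) ea).
    by have [-> _] := new_vertex_inj i1_gt0 (ltnW i1len) (ltn0Sn _) (ltnW klen) (etrans (esym e1) eb).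
have inf : infinite_set (w m0 @` `I_(len m0)).
  apply: (@infinite_of_inj _ _ R) => [n|n n' e]; last exact: Rinj.
  by have [i [_ ilen ->]] := stay n; exists i.
by apply: inf; apply: finite_image; exact: finite_II.
Qed.

(** A subdivided edge at x that starts towards the root follows the path q to the
root and is contained in it.  Any other one starts with the first edge of some path
w n attached at x, so it is this path. *)
Lemma tree_uniform :
  (forall n m, source n = source m -> len n = len m) -> uniform_subdivision_Tomega H.
Proof.
move=> lenE; split; first exact: tree_subdivision.
exists b0; first exact: (branch_of_branch_vertex 0).
suff outer x k q m p : branch_vertex H x -> fpath_between H x b0 k q ->
    subdivided_edge H x m p -> ~ (p @` `I_m `<=` q @` `I_k) ->
    exists2 n, b (source n) = x & m = (len n).+1.
  move=> x k q xb qP m p m' p' pP np pP' np'.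
  have [n en ->] := outer _ _ _ _ _ xb qP pP np.
  have [n' en' ->] := outer _ _ _ _ _ xb qP pP' np'.
  by congr succn; apply: lenE; apply: branch_of_inj; rewrite en.
move=> xb qB [y [yb nyx [pP m0 p0 pm] pin]] npq.
case: m m0 pm pP pin npq => [//|[|m]] _ /= pm pP pin npq.
  by case: nyx; rewrite -pm.
have /walk_onP[pV pinj pE] := pP.
have inner_nb i : 0 < i -> i.+1 < m.+2 -> ~ branch_vertex H (p i).
  move=> i0 im ib; have [e|e] := pin i (ltnW im) ib.
    by have := pinj i 0 (ltnW im) isT; rewrite p0 => /(_ e) ei; rewrite ei in i0.
  have := pinj i m.+1 (ltnW im) (ltnSn _); rewrite pm => /(_ e) ei.
  by rewrite ei ltnn in im.
have := pE 0 isT isT; rewrite p0 => adj; case: (parent_graph_adj adj) => -[Vx [nr ep]].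
  case: npq; case: qB => qP k0 q0 qk.
  have k1 : 1 < k.
    by case: k k0 qk {qP} => [|[|k]] //= _ qk; case: nr; rewrite -q0 -qk.
  have /walk_onP[qV qinj qE] := qP.
  have eq1 : p 1 = q 1.
    have := qE 0 k0 k1; rewrite q0 => adj'; case: (parent_graph_adj adj') => -[Vq [nr' eq]].
      by rewrite ep eq.
    case: k qP k0 k1 qk {qV qinj qE} => [|[|k]] // qP _ _ /= qk.
    have := first_step_down qP q0 Vq nr' eq; rewrite qk => bq.
    have [e|] := below_depth tree_parent bq; first by case: nr'.
    by rewrite d_root.
  have pq := paths_follow tree_subdivision pP qP (etrans p0 (esym q0)) eq1 inner_nb.
  have mk : m.+2 <= k.
    rewrite leqNgt; apply/negP => km; case: k k0 k1 km qk pq {qP qV qinj qE} => [|k] // _ k0.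
    rewrite ltnS /= => km qk pq; have ekr : p k = b0 by rewrite pq // ltnW.
    by apply: (inner_nb k) => //; rewrite ekr; exact: (branch_of_branch_vertex 0).
  move=> _ [i im <-]; exists i; first exact: leq_trans im mk.
  by rewrite pq // (leq_trans im).
case: Vx => [//|[n [i [ilen e]]]]; have [ep' _] := par_w ilen.
have ex : x = w n i by rewrite ep e ep'.
have i0 : i = 0.
  case: i ilen e ep' ex => // i ilen _ _ ex.
  by case: (@inner_not_branch_vertex n i.+1 isT ilen); rewrite -ex.
subst i; exists n; first by rewrite -w0.
have pw := paths_follow tree_subdivision pP (path_fpath n) (etrans p0 ex) e inner_nb.
have [lt|lt|//] := ltngtP m.+2 (len n).+1.
- case: (@inner_not_branch_vertex n m.+1) => //.
  by rewrite -(pw m.+1) ?pm // ltnW.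
- case: (inner_nb (len n)) => //.
  by rewrite (pw (len n)) //; [exact: (branch_of_branch_vertex n.+1)|exact: ltnW].
Qed.
End Assembly.

(** With K x a singleton for each x in Y, all paths attached at a branch vertex
have the same length, which makes the subdivision uniform. *)
Lemma kernel_subdivision : exists H : graph T,
  [/\ subgraph H G, countable (vertices H), subdivision_Tomega H &
      (forall x k k', Y x -> K x k -> K x k' -> k = k') ->
      uniform_subdivision_Tomega H].
Proof.
have [w wP] := kernel_paths.
have len_gt0 n : 0 < (w n).2 by have [[]] := wP n.
have pathP n : fpath G (w n).2.+1 (w n).1 by have [] := wP n.
have w0 n : (w n).1 0 = branch_of w (source n) by have [] := wP n.
have w_new n := let: And5 _ _ _ _ new := wP n in new.
have [par [d [d_root par_w]]] := parent_data pathP w_new.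
have Yb j : Y (branch_of w j) by case: j => [//|j]; have [] := wP j.
pose VP := tree_parent len_gt0 w0 d_root par_w.
exists (parent_graph VP); split.
- split=> [v [->|[n [i [ilen ->]]]]|_ [v [Vv nb ->]]].
  + by have /walk_onP[+ _ _] := pathP 0 => /(_ 0 isT); rewrite w0.
  + by have /walk_onP[+ _ _] := pathP n; apply.
  + case: Vv => [//|[n [i [ilen ->]]]]; have [-> _] := par_w _ _ ilen.
    by have /walk_onP[_ _ pE] := pathP n; rewrite setUC; apply: pE => //; exact: ltnW.
- exact: tree_vertices_countable.
- exact: tree_subdivision.
move=> Kuniq; apply: tree_uniform => // n m e.
have [[Kn _] _ _ _ _] := wP n; have [[Km _] _ _ _ _] := wP m.
by apply: Kuniq (Yb (source n)) Kn _; rewrite e.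
Qed.
End KernelTree.

(** * Walking through a subdivision block by block *)

(** Good k p is meant for properties of the first k values of p: finite paths
that can always be extended within Good have a ray as their limit. *)
Lemma limit_ray (T : Type) (H : graph T) (Good : nat -> (nat -> T) -> Prop) k0 p0 :
  (forall k p, Good k p -> fpath H k p) -> Good k0 p0 ->
  (forall k p, Good k p -> exists k' p', [/\ k < k', Good k' p' &
     forall i, i < k -> p' i = p i]) ->
  exists R, ray H R /\ forall N, exists k p, [/\ N <= k, Good k p &
    forall i, i < k -> R i = p i].
Proof.
move=> Gpath G0 Gext.
have [|nx nxP] := @choice _ _ (fun s s' : nat * (nat -> T) => Good s.1 s.2 ->
  [/\ s.1 < s'.1, Good s'.1 s'.2 & forall i, i < s.1 -> s'.2 i = s.2 i]).
  move=> [k p] /=; have [/Gext[k' [p' kp']]|] := pselect (Good k p); last by exists (k, p).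
  by exists (k', p').
pose s n := iter n nx (k0, p0).
have sG n : Good (s n).1 (s n).2 by elim: n => //= n /nxP[].
have s_lt n : (s n).1 < (s n.+1).1 by have [] := nxP _ (sG n).
have s_ge n : n <= (s n).1 by elim: n => // n IH; exact: leq_ltn_trans IH (s_lt n).
have s_mono n m : n <= m -> (s n).1 <= (s m).1.
  move=> /subnKC <-; elim: (m - n) => [|j IH]; first by rewrite addn0.
  by rewrite addnS (leq_trans IH) // ltnW.
have s_eq n m i : n <= m -> i < (s n).1 -> (s m).2 i = (s n).2 i.
  move=> nm ilt; rewrite -(subnKC nm); elim: (m - n) => [|j IH]; first by rewrite addn0.
  rewrite addnS -IH; have [_ _] := nxP _ (sG (n + j)); apply.
  by apply: leq_trans ilt _; apply: s_mono; exact: leq_addr.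
pose R i := (s i.+1).2 i.
have RE n i : i < (s n).1 -> R i = (s n).2 i.
  move=> ilt; have /orP[le|le] := leq_total n i.+1; first exact: s_eq.
  by rewrite /R (s_eq _ _ _ le) //; exact: (s_ge i.+1).
exists R; split; last by move=> N; exists (s N).1, (s N).2; split=> // i; exact: RE.
apply/walk_onP; split=> [n _|i j _ _ e|n _ _].
- have /walk_onP[pV _ _] := Gpath _ _ (sG n.+1).
  by rewrite (RE n.+1); [apply: pV|]; exact: s_ge.
- have /walk_onP[_ pinj _] := Gpath _ _ (sG (maxn i j).+1).
  have ii : i < (s (maxn i j).+1).1 by apply: leq_trans (s_ge _); rewrite ltnS leq_maxl.
  have jj : j < (s (maxn i j).+1).1 by apply: leq_trans (s_ge _); rewrite ltnS leq_maxr.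
  by apply: pinj => //; rewrite -!RE.
- have /walk_onP[_ _ pE] := Gpath _ _ (sG n.+2).
  have n1 : n.+1 < (s n.+2).1 by exact: s_ge.
  by rewrite (RE n.+2) ?(RE n.+2 n.+1) //; [apply: pE => //|]; exact: ltnW.
Qed.

Definition snoc_walk (T : Type) k (p : nat -> T) z n := if n <= k then p n else z.

Section Blocks.
Variables (T : Type) (H : graph T).
Implicit Types (p q : nat -> T).

Lemma fpath_snoc k p z : fpath H k.+1 p -> edges H [set p k; z] ->
  (forall i, i <= k -> p i <> z) -> fpath H k.+2 (snoc_walk k p z).
Proof.
move=> /walk_onP[pV pinj pE] Hz nz.
have Vz : vertices H z.
  have [x [y [Hx Hy _ e]]] := edgesP Hz.
  by have [->|->] : [set x; y] z by rewrite -e; right.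
apply/walk_onP; rewrite /snoc_walk; split=> [n _|i j /= ik jk|n /= nk n1k].
- by case: leqP => // nk; exact: pV.
- case: leqP => ki; case: leqP => kj e //.
  + exact: pinj.
  + by have := nz _ ki.
  + by have := nz _ kj; rewrite e.
  + by apply/eqP; rewrite eqn_leq; apply/andP; split;
      [apply: leq_trans kj|apply: leq_trans ki].
- have {}nk : n <= k by rewrite -ltnS -ltnS.
  rewrite nk /=; case: (leqP n.+1 k) => [lt|ge]; first exact: pE.
  by have -> : n = k by apply/eqP; rewrite eqn_leq nk.
Qed.

(** The edge and the path segment it would close up are two paths with the same
ends. *)
Lemma tree_no_return m q y : tree H -> fpath H m.+1 q -> 0 < m ->
  edges H [set q m; y] -> y <> q m.-1 -> forall i, i <= m -> q i <> y.
Proof.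
move=> [_ tH] qP m0 Hy ny i im e.
have nqy : q m <> y.
  move=> ee; have [x [z [_ _ nxz exz]]] := edgesP Hy.
  by case: (set2_eq exz) => -[ex ez]; apply: nxz; rewrite -ex -ez ?ee.
have /walk_onP[qV _ _] := qP.
have Vi : vertices H y by rewrite -e; exact: qV.
have Vm : vertices H (q m) by apply: qV => /=.
have [_ uniq] := tH y (q m) Vi Vm.
pose t n := if n is 0 then y else q m.
have tP : fpath_between H y (q m) 2 t.
  split=> //; apply/walk_onP; split=> [[|n] _ //|i' j' i2 j2 e1|].
  - by case: i' j' i2 j2 e1 => [|[|i']] [|[|j']] // _ _ e1; case: nqy.
  - by case=> [_ _|[|n]] //=; rewrite setUC.
have qB : fpath_between H y (q m) (m - i).+1 (fun n => q (i + n)).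
  split=> //; last by rewrite /= subnKC.
    by apply: fpath_shift qP; rewrite addnS subnKC.
  by rewrite addn0.
have [[mi] _] := uniq _ _ _ _ qB tP.
apply: ny; rewrite -e; congr q.
by rewrite -(subnKC im) mi addn1.
Qed.

(** Vertices of degree two let the path continue, and trees prevent it from
returning; if no branch vertex were ever reached, the limit would be a ray without
branch vertices. *)
Lemma extend_to_branch k p z : subdivision_Tomega H -> fpath H k.+1 p ->
  edges H [set p k; z] -> (forall i, i <= k -> p i <> z) ->
  exists k' p', [/\ k < k', fpath H k'.+1 p', branch_vertex H (p' k'),
    (forall i, i <= k -> p' i = p i) /\ p' k.+1 = z &
    forall i, k < i -> i < k' -> ~ branch_vertex H (p' i)].
Proof.
move=> sub pP Hz nz; apply: contrapT => nex.
pose Good n q := exists2 m, n = m.+1 & [/\ k < m, fpath H m.+1 q,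
  (forall i, i <= k -> q i = p i) /\ q k.+1 = z &
  forall i, k < i -> i <= m -> ~ branch_vertex H (q i)].
have [|||R [rayR Rlim]] := @limit_ray T H Good k.+2 (snoc_walk k p z).
- by move=> n q [m -> []].
- exists k.+1 => //; have sP := fpath_snoc pP Hz nz.
  have sE : (forall i, i <= k -> snoc_walk k p z i = p i) /\ snoc_walk k p z k.+1 = z.
    by split=> [i ik|]; rewrite /snoc_walk ?ik ?ltnn.
  split=> // i ki ik; have -> : i = k.+1 by apply/eqP; rewrite eqn_leq ki ik.
  move=> zb; apply: nex; exists k.+1, (snoc_walk k p z); split=> // j kj.
  by rewrite ltnS leqNgt kj.
- move=> n q [m -> [km qP qE qnb]].
  have /walk_onP[qV qinj qedge] := qP.
  have deg : (incident H (q m) #= `I_2)%card.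
    by apply: degree_two => //; [apply: qV => /=|exact: qnb].
  have m0 : 0 < m by case: m km {qP qnb qV qinj qedge deg}.
  have [y Hy ny] : exists2 y, edges H [set q m; y] & y <> q m.-1.
    have /card_pair[e1 [e2 [ne ee]]] := deg.
    have [e [He em] nee] : exists2 e, incident H (q m) e & e <> [set q m; q m.-1].
      have [e1E|] := pselect (e1 = [set q m; q m.-1]); last by exists e1; rewrite // ee; left.
      by exists e2; [rewrite ee; right|rewrite -e1E => /esym].
    have [x [y [_ _ _ exy]]] := edgesP He.
    have [qx|qy] : [set x; y] (q m) by rewrite -exy.
      exists y; first by rewrite qx -exy.
      by move=> ey; apply: nee; rewrite exy qx ey.
    exists x; first by rewrite qy setUC -exy.
    by move=> ex; apply: nee; rewrite exy qy ex setUC.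
  have [tH _ _] := sub; have nr := tree_no_return tH qP m0 Hy ny.
  have sP := fpath_snoc qP Hy nr.
  have sE i : i <= m -> snoc_walk m q y i = q i by rewrite /snoc_walk => ->.
  have sm : snoc_walk m q y m.+1 = y by rewrite /snoc_walk ltnn.
  exists m.+2, (snoc_walk m q y); split=> //.
  have sk : (forall i, i <= k -> snoc_walk m q y i = p i) /\ snoc_walk m q y k.+1 = z.
    case: qE => qE qk; split=> [i ik|]; rewrite sE // ?qE //.
    by rewrite (leq_trans ik) // ltnW.
  exists m.+1 => //; split=> // [|i ki]; first exact: ltnW.
  rewrite leq_eqVlt ltnS => /orP[/eqP ->|im]; last by rewrite sE //; exact: qnb.
  move=> yb; apply: nex; exists m.+1, (snoc_walk m q y); split=> //; first exact: ltnW.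
  by move=> j kj jm; rewrite sE //; exact: qnb.
have [_ _ /(_ _ (ray_shift k.+1 rayR))[n]] := sub.
have [n' [q [Nm [m en [km _ _ qnb]] RE]]] := Rlim (k.+1 + n).+1; subst n'.
by rewrite RE //; apply: qnb; rewrite ?ltnS ?leq_addr // -ltnS.
Qed.

End Blocks.

Section BlockStructure.
Variables (T : Type) (H : graph T) (r : T).
Hypothesis subH : subdivision_Tomega H.
Hypothesis branch_r : branch_vertex H r.

Lemma branch_neighbours x : branch_vertex H x ->
  exists2 z : nat -> T, injective z & forall n, edges H [set x; z n].
Proof.
move=> [_ /infiniteP/(card_le_inj set0)[e eH einj]].
have [|z zP] := @choice _ _ (fun n z => e n = [set x; z]).
  move=> n; have [He ex] := eH n I; have [y [z [_ _ _ eyz]]] := edgesP He.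
  have [xy|xz] : [set y; z] x by rewrite -eyz.
    by exists z; rewrite xy.
  by exists y; rewrite xz setUC.
exists z => [n m zz|n]; first by apply: einj => //; rewrite !zP zz.
by rewrite -zP; have [] := eH n I.
Qed.

(** A state s is a path with the index of its last vertex, a branch vertex;
z x lists infinitely many neighbours of x.  The state s' prolongs s by the block
that begins with the n-th neighbour. *)
Record block_extends (z : T -> nat -> T) (s : (nat -> T) * nat) (n : nat)
    (s' : (nat -> T) * nat) : Prop := BlockExtends {
  block_lt : s.2 < s'.2;
  block_path : fpath H s'.2.+1 s'.1;
  block_end : branch_vertex H (s'.1 s'.2);
  block_prefix : forall i, i <= s.2 -> s'.1 i = s.1 i;
  block_first : s'.1 s.2.+1 = z (s.1 s.2) n;
  block_inner : forall i, s.2 < i -> i < s'.2 -> ~ branch_vertex H (s'.1 i)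
}.

Lemma eventually_off_path (z : nat -> T) (p : nat -> T) k : injective z ->
  exists N, forall n, N <= n -> forall i, i <= k -> p i <> z n.
Proof.
move=> zinj; have one i : exists N, forall n, N <= n -> p i <> z n.
  have [[n e]|nex] := pselect (exists n, p i = z n); last first.
    by exists 0 => n _ e; apply: nex; exists n.
  by exists n.+1 => m nm; rewrite e => /zinj e'; rewrite e' ltnn in nm.
elim: k => [|k [N IH]].
  by have [N NP] := one 0; exists N => n Nn [|//] _; exact: NP.
have [M MP] := one k.+1; exists (maxn N M) => n.
rewrite geq_max => /andP[Nn Mn] i; rewrite leq_eqVlt ltnS => /orP[/eqP ->|ik].
  exact: MP.
exact: IH.
Qed.

(** States are indexed by words recording the block numbers chosen, last choice
first, so that there are countably many of them.  The function idx is well defined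
because the path from r to a vertex v is unique: the last branch vertex before v
and the neighbour chosen there can be read off from v. *)
Lemma block_structure : exists (st : seq nat -> (nat -> T) * nat) (idx : T -> nat),
  (forall u, [/\ fpath_between H r ((st u).1 (st u).2) (st u).2.+1 (st u).1,
     branch_vertex H ((st u).1 (st u).2) &
     exists N, forall n, N <= n -> exists2 z, block_extends z (st u) n (st (n :: u)) &
       forall i, (st u).2 < i -> i <= (st (n :: u)).2 ->
         idx ((st (n :: u)).1 i) = n]).
Proof.
have [|z zP] := @choice _ _ (fun x (z : nat -> T) => branch_vertex H x ->
    injective z /\ forall n, edges H [set x; z n]).
  move=> x; have [/branch_neighbours[z zi zE]|] := pselect (branch_vertex H x).
    by exists z.
  by exists (fun=> r).
have [|ex exP] := @choice _ _ (fun sn (s' : (nat -> T) * nat) =>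
  ((exists s', block_extends z sn.1 sn.2 s') -> block_extends z sn.1 sn.2 s') /\
  (~ (exists s', block_extends z sn.1 sn.2 s') -> s' = sn.1)).
  move=> sn; have [[s' sP]|nex] := pselect (exists s', block_extends z sn.1 sn.2 s').
    by exists s'; split=> // -[]; exists s'.
  by exists sn.1; split.
have [st [st0 stS]] : exists st : seq nat -> (nat -> T) * nat,
    st [::] = (fun=> r, 0) /\ forall n u, st (n :: u) = ex (st u, n).
  by exists (foldr (fun n s => ex (s, n)) (fun=> r, 0)).
have stP u : [/\ fpath H (st u).2.+1 (st u).1, branch_vertex H ((st u).1 (st u).2) &
    (st u).1 0 = r].
  elim: u => [|n u [pP pb p0]]; rewrite ?st0 ?stS /=.
    split=> //; apply/walk_onP; split=> [n _|[|i] [|j] //|[|n] //].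
    by have [] := branch_r.
  have [exE exN] := exP (st u, n).
  have [/exE E|/exN -> //] := pselect (exists s', block_extends z (st u) n s').
  by split; [exact: block_path E|exact: block_end E|rewrite (block_prefix E)].
have [|idx idxP] := @choice _ _ (fun v m => forall u n i,
    block_extends z (st u) n (st (n :: u)) ->
    (st u).2 < i -> i <= (st (n :: u)).2 -> v = (st (n :: u)).1 i -> m = n).
  move=> v; have [[u [n [i [E ui ile ev]]]]|nex] := pselect (exists u n i,
    [/\ block_extends z (st u) n (st (n :: u)),
    (st u).2 < i, i <= (st (n :: u)).2 & v = (st (n :: u)).1 i]); last first.
    by exists 0 => u n i E ui ile ev; case: nex; exists u, n, i.
  exists n => u' n' i' E' ui' ile' ev'.
  have [[_ uniq] _ _] := subH.
  have prefix w j : j <= (st w).2 ->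
      fpath_between H r ((st w).1 j) j.+1 (st w).1.
    move=> jw; have [wP _ w0] := stP w; split=> //.
    exact: fpath_prefix wP.
  have P1 := prefix _ _ ile; have P2 := prefix _ _ ile'; rewrite -ev' ev in P2.
  have Vv : vertices H ((st (n :: u)).1 i).
    by have /walk_onP[pV _ _] := block_path E; exact: pV.
  have [_ /(_ _ _ _ _ P1 P2)[[eii] pq]] := uniq _ _ (proj1 branch_r) Vv.
  subst i'.
  (* Two blocks that contain the same vertex start at the same position: the
     later start would be a branch vertex inside the other block. *)
  have no_lt a m b m' (Ea : block_extends z (st a) m (st (m :: a)))
      (Eb : block_extends z (st b) m' (st (m' :: b))) :
      (st a).2 < i -> i <= (st (m :: a)).2 -> (st b).2 < i ->
      (forall j, j < i.+1 -> (st (m :: a)).1 j = (st (m' :: b)).1 j) ->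
      ~~ ((st a).2 < (st b).2).
    move=> ai ia bi eqj; apply/negP => ab.
    apply: (block_inner Ea ab); first exact: leq_trans bi ia.
    rewrite eqj ?(block_prefix Eb) //; last exact: ltnW.
    by have [] := stP b.
  have euu : (st u).2 = (st u').2.
    apply/eqP; rewrite eqn_leq; apply/andP; split; rewrite leqNgt.
      exact: (no_lt _ _ _ _ E' E ui' ile' ui (fun j ji => esym (pq j ji))).
    exact: (no_lt _ _ _ _ E E' ui ile ui' pq).
  have [_ zb _] := stP u; have [zinj _] := zP _ zb; apply: zinj.
  rewrite -(block_first E) pq // euu (block_first E'); congr (z _ _).
  by rewrite -(block_prefix E') // -pq ?(block_prefix E) ?euu // ltnW.
exists st, idx => u; have [uP ub u0] := stP u; split=> //.
have [zinj zE] := zP _ ub.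
have [N NP] := eventually_off_path (st u).1 (st u).2 zinj.
exists N => n Nn; have E : block_extends z (st u) n (st (n :: u)).
  have [exE _] := exP (st u, n); rewrite stS; apply: exE.
  have [k' [p' [kk' pP pb [pre fst] inn]]] := extend_to_branch subH uP (zE n) (NP n Nn).
  by exists (p', k').
by exists z => // i ui ile; exact: (idxP _ u n i).
Qed.

End BlockStructure.

(** * Labellings of subdivisions *)

Lemma subdivision_has_branch (T : Type) (H : graph T) :
  subdivision_Tomega H -> exists r, branch_vertex H r.
Proof.
move=> sub; have [[[x Hx] _] _ _] := sub.
have [xb|nb] := pselect (branch_vertex H x); first by exists x.
have /card_pair[e1 [e2 [_ ee]]] := degree_two sub Hx nb.
have [He ex] : incident H x e1 by rewrite ee; left.
have [y [z [_ _ nyz eyz]]] := edgesP He.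
have [v Hv nv] : exists2 v, edges H [set x; v] & x <> v.
  have [xy|xz] : [set y; z] x by rewrite -eyz.
    by exists z; rewrite xy // -eyz.
  by exists y; [rewrite xz setUC -eyz|rewrite xz => /esym].
have cP : fpath H 1 (fun=> x).
  by apply/walk_onP; split=> [n _|[|i] [|j] //|[|n] //].
have [|k [p [_ _ pb _ _]]] := extend_to_branch sub cP Hv; first by [].
by exists (p k).
Qed.

(** If in every state some block has a label phi n above all values of f up to the
end of that block, such blocks can be concatenated for ever. *)
Lemma block_ray (T : Type) (H : graph T) (st : seq nat -> (nat -> T) * nat)
    (idx : T -> nat) (phi f : nat -> nat) :
  (forall u, fpath H (st u).2.+1 (st u).1) ->
  (forall u, exists n, [/\ (st u).2 < (st (n :: u)).2,
     forall i, i <= (st u).2 -> (st (n :: u)).1 i = (st u).1 i,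
     forall i, (st u).2 < i -> i <= (st (n :: u)).2 -> idx ((st (n :: u)).1 i) = n &
     forall i, i <= (st (n :: u)).2 -> f i <= phi n]) ->
  exists2 R, ray H R & dominates (phi \o idx \o R) f.
Proof.
move=> stP stE.
pose Good k p := exists u, [/\ k = (st u).2.+1, p = (st u).1 &
  forall i, (st [::]).2 < i -> i <= (st u).2 -> f i <= phi (idx (p i))].
have [|||R [rayR Rlim]] := @limit_ray T H Good (st [::]).2.+1 (st [::]).1.
- by move=> k p [u [-> ->]].
- by exists [::]; split=> // i; rewrite ltnNge => /negP.
- move=> k p [u [-> -> uf]]; have [n [lt pre idxn fn]] := stE u.
  exists (st (n :: u)).2.+1, (st (n :: u)).1; split=> //.
  exists (n :: u); split=> // i i0 ile; have [iu|ui] := leqP i (st u).2.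
    by rewrite pre //; exact: uf.
  by rewrite idxn //; exact: fn.
exists R => //; apply/dominatesP; exists (st [::]).2.+1 => i i0.
have [k [p [ik [u [ek ep uf]] RE]]] := Rlim i.+1; subst k.
by rewrite /= RE //; exact: uf.
Qed.

(** The function h' bounds, up to finitely many n, the position where block n
ends, for all states at once.  Wherever the hull of f is below g at some m with
h' n <= m < h' n.+1, the label phi n is at least g m, while f is at most its hull
at h' n along the block. *)
Lemma subdivision_dominates (T : Type) (H : graph T) (g : nat -> nat) :
  subdivision_Tomega H -> exists L : T -> nat, forall f,
    ~ dominates (monotone_hull f) g ->
    exists2 R, ray H R & dominates (L \o R) f.
Proof.
move=> sub; have [r rb] := subdivision_has_branch sub.
have [st [idx stP]] := block_structure sub rb.
have [h hP] := @countable_bounded _ setT (fun u n => (st (n :: u)).2)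
  (countableP [set: seq nat]).
(* The summand n makes h' unbounded, so that its values cut the natural
   numbers into intervals. *)
pose h' n := monotone_hull h n + n.
have h'_mono m n : m <= n -> h' m <= h' n.
  by move=> mn; rewrite leq_add // monotone_hull_mono.
(* The argument h' n.+1 rather than h' n: the place m where g is large is only
   known to lie somewhere in the interval from h' n to h' n.+1. *)
pose phi n := monotone_hull g (h' n.+1).
exists (phi \o idx) => f /not_dominates_often often.
apply: (block_ray (st := st)) => u; first by have [[]] := stP u.
have [_ _ [N NP]] := stP u; have /dominatesP[N' hN'] := hP u I.
have [m mN fm] := often (h' (maxn N N')).
have [n [nN hn hn1]] : exists n, [/\ maxn N N' <= n, h' n <= m & m < h' n.+1].
  have ex : exists n, m < h' n by exists m.+1; rewrite /h' (leq_trans (ltnSn m)) ?leq_addl.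
  case: (ex_minnP ex) => -[|n] mn minn.
    by move: mn; rewrite ltnNge (leq_trans (h'_mono _ _ (leq0n _)) mN).
  exists n; split=> //; rewrite leqNgt; apply/negP => lt.
    by have := leq_trans (leq_trans mn (h'_mono _ _ lt)) mN; rewrite ltnn.
  by have := minn _ lt; rewrite ltnn.
move: nN; rewrite geq_max => /andP[Nn N'n].
have [z E idxn] := NP n Nn; exists n; split=> //; first exact: block_lt E.
  exact: block_prefix E.
move=> i ile; apply: leq_trans (_ : g m <= _); last exact/monotone_hull_ge/ltnW.
apply: leq_trans (ltnW fm); apply: monotone_hull_ge; apply: leq_trans hn.
apply: (leq_trans ile); apply: (leq_trans (hN' n N'n)).
by rewrite /h' (leq_trans (monotone_hull_ge h (leqnn n))) ?leq_addr.
Qed.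

(** Blocks with large numbers are subdivided edges leading away from the root, so
they all end at the same position ell; a number above f on the positions up to ell
can be chosen afterwards. *)
Lemma uniform_dominates (T : Type) (H : graph T) :
  uniform_subdivision_Tomega H -> exists L : T -> nat, forall f,
    exists2 R, ray H R & dominates (L \o R) f.
Proof.
move=> [sub [r rb unif]]; have [st [idx stP]] := block_structure sub rb.
exists (id \o idx) => f.
apply: (block_ray (st := st)) => u; first by have [[]] := stP u.
have [pB xb [N NP]] := stP u.
have rB := fpath_between_rev pB.
have edge n : N <= n ->
    subdivided_edge H ((st u).1 (st u).2) ((st (n :: u)).2 - (st u).2).+1
      (fun i => (st (n :: u)).1 ((st u).2 + i)) /\
    ~ ((fun i => (st (n :: u)).1 ((st u).2 + i)) @` `I_((st (n :: u)).2 - (st u).2).+1 `<=`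
       (fun i => (st u).1 ((st u).2.+1.-1 - i)) @` `I_(st u).2.+1).
  move=> Nn; have [z [lt pP eb pre _ inner] _] := NP n Nn.
  have /walk_onP[_ pinj _] := pP; split.
    exists ((st (n :: u)).1 (st (n :: u)).2); split=> //.
    - move=> e; have := pinj (st (n :: u)).2 (st u).2 (ltnSn _) (ltnW lt).
      by rewrite e pre // => /(_ erefl) e'; rewrite e' ltnn in lt.
    - split=> //; [|by rewrite addn0 pre|by rewrite /= subnKC // ltnW].
      by apply: fpath_shift pP; rewrite addnS subnKC // ltnW.
    - move=> [|i] ile ib; first by left; rewrite addn0 pre.
      right; congr (_ _); apply/eqP; rewrite eqn_leq; apply/andP; split.
        by rewrite -leq_subRL // ltnW.
      rewrite leqNgt; apply/negP => lt'; apply: inner ib => //.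
      by rewrite addnS ltnS leq_addr.
  move=> sub'; have [|j jle e] := sub' ((st (n :: u)).1 (st u).2.+1).
    by exists 1; [rewrite /= ltnS subn_gt0|rewrite addn1].
  have jle' := leq_subr j (st u).2.
  have e' : (st u).2 - j = (st u).2.+1.
    apply: pinj; [|exact: lt|by rewrite pre].
    by rewrite /= ltnS (leq_trans jle') // ltnW.
  by rewrite e' ltnn in jle'.
pose ell := (st (N :: u)).2.
have ellE n : N <= n -> (st (n :: u)).2 = ell.
  move=> Nn; have [En nn] := edge n Nn; have [EN nN] := edge N (leqnn N).
  have [] := unif _ _ _ xb rB _ _ _ _ En nn EN nN.
  have [_ [ltn _ _ _ _ _] _] := NP n Nn; have [_ [ltN _ _ _ _ _] _] := NP N (leqnn N).
  move=> e; rewrite /ell -(subnKC (ltnW ltn)) e subnKC // ltnW //.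
pose n := maxn N (monotone_hull f ell).
have [z E idxn] := NP n (leq_maxl _ _); exists n; split=> //.
- exact: block_lt E.
- exact: block_prefix E.
move=> i; rewrite ellE ?leq_maxl // => ile.
by apply: leq_trans (leq_maxr _ _); exact: monotone_hull_ge.
Qed.

(** * From disjoint subgraphs to a labelling *)

Lemma ray_subgraph (T : Type) (H G : graph T) R : subgraph H G -> ray H R -> ray G R.
Proof.
move=> [sV sE] /walk_onP[RV Rinj RE]; apply/walk_onP; split=> // n.
  by move=> /RV/sV.
by move=> n0 n1; apply: sE; exact: RE.
Qed.

Lemma disjoint_subdivisions_dominate (T : Type) (G : graph T)
    (B : set (nat -> nat)) (H : (nat -> nat) -> graph T) :
  unbounded_family B ->
  (forall i, B i -> subgraph (H i) G /\ subdivision_Tomega (H i)) ->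
  (forall i j, B i -> B j -> i <> j -> vertices (H i) `&` vertices (H j) = set0) ->
  dominating_graph G.
Proof.
move=> unbB BH disj.
have [|Li LiP] := @choice _ _ (fun i (L : T -> nat) => B i -> forall f,
    ~ dominates (monotone_hull f) i ->
    exists2 R, ray (H i) R & dominates (L \o R) f).
  move=> i; have [Bi|] := pselect (B i); last by exists (fun=> 0).
  by have [L LP] := subdivision_dominates i (proj2 (BH i Bi)); exists L.
have [|L LP] := @choice _ _ (fun v n => forall i, B i -> vertices (H i) v -> n = Li i v).
  move=> v; have [[i [Bi Hi]]|nex] := pselect (exists i, B i /\ vertices (H i) v).
    exists (Li i v) => j Bj Hj; have [->//|nij] := pselect (i = j).
    by have : (vertices (H i) `&` vertices (H j)) v by []; rewrite disj.
  by exists 0 => i Bi Hi; case: nex; exists i.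
exists L => f.
have [i Bi nfi] : exists2 i, B i & ~ dominates (monotone_hull f) i.
  apply: contrapT => nex; apply: unbB; exists (monotone_hull f) => i Bi.
  by apply: contrapT => nd; apply: nex; exists i.
have [R rayR RL] := LiP i Bi f nfi.
exists R; first by apply: ray_subgraph rayR; have [] := BH i Bi.
have -> : L \o R = Li i \o R; last by [].
apply/funext => n /=; apply: LP => //.
by have /walk_onP[RV _ _] := rayR; exact: RV.
Qed.

Lemma disjoint_rays_dominate (T : Type) (G : graph T)
    (D : set (nat -> nat)) (R : (nat -> nat) -> nat -> T) :
  dominating_family D -> (forall i, D i -> ray G (R i)) ->
  (forall i j, D i -> D j -> i <> j -> range (R i) `&` range (R j) = set0) ->
  dominating_graph G.
Proof.
move=> domD DR disj.
have [|L LP] := @choice _ _ (fun v m => forall i n, D i -> v = R i n -> m = i n).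
  move=> v; have [[i [n [Di ->]]]|nex] := pselect (exists i n, D i /\ v = R i n).
    exists (i n) => j n' Dj e; have [eij|nij] := pselect (i = j).
      have /walk_onP[_ Rinj _] := DR _ Dj; subst j.
      by rewrite (Rinj _ _ I I e).
    have : (range (R i) `&` range (R j)) (R i n).
      by split; [exists n|exists n'].
    by rewrite disj.
  by exists 0 => i n Di e; case: nex; exists i, n.
exists L => f; have [i Di fi] := domD f.
exists (R i); first exact: DR.
have -> // : L \o R i = i.
by apply/funext => n /=; exact: LP.
Qed.

(** * From a labelling to disjoint subgraphs *)

Lemma has_card_b_exists : exists B, has_card_b B.
Proof.
apply: least_card_exists; exists setT => -[g gP].
have /dominatesP[N /(_ N (leqnn N))] := gP (fun n => (g n).+1) I.
by rewrite ltnn.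
Qed.

Lemma has_card_d_exists : exists D, has_card_d D.
Proof.
apply: least_card_exists; exists setT => g; exists g => //.
by apply/dominatesP; exists 0.
Qed.

Lemma least_card_index (P : set (set (nat -> nat))) (F : set (nat -> nat))
    (I : Type) (i0 : I) (M : set I) (g : I -> nat -> nat) :
  least_card P F -> P (g @` M) ->
  exists2 s : (nat -> nat) -> I, (forall f, F f -> M (s f)) &
    forall f f', F f -> F f' -> s f = s f' -> f = f'.
Proof.
move=> [_ least] PM; apply: card_le_inj => //.
exact: card_le_trans (least _ PM) (card_image_le g M).
Qed.

Section DeleteVertices.
Variables (T : Type) (G : graph T) (U : set T).

Definition remaining_edges := [set e | edges G e /\ e `&` U = set0].

Lemma remaining_edgesP e : remaining_edges e -> exists x y,
  [/\ (vertices G `\` U) x, (vertices G `\` U) y, x <> y & e = [set x; y]].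
Proof.
move=> [Ge eU]; have [x [y [Gx Gy nxy exy]]] := edgesP Ge; exists x, y.
have nU v : e v -> ~ U v by move=> ev Uv; have : (e `&` U) v by []; rewrite eU.
by split=> //; split=> //; apply: nU; rewrite exy; [left|right].
Qed.

Definition delete_vertices : graph T := Graph remaining_edgesP.

Lemma delete_vertices_subgraph : subgraph delete_vertices G.
Proof. by split=> [x []|e []]. Qed.

Lemma ray_delete_vertices R :
  ray G R -> (forall n, ~ U (R n)) -> ray delete_vertices R.
Proof.
move=> /walk_onP[RV Rinj RE] nU; apply/walk_onP; split=> // n _; first by split; [exact: RV|].
move=> _; split; first exact: RE.
by apply/seteqP; split=> // x [[->|->] Ux]; [exact: (nU n)|exact: (nU n.+1)].
Qed.

End DeleteVertices.

Section Bounds.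
Variables (T : Type) (G : graph T) (L : T -> nat).

(** In a nonempty set where no vertex is separated, each x has a length ell x
for which the paths to the set are not cut by a finite set.  These lengths yield a
uniform subdivision. *)
Lemma bounds_without_uniform :
  ~ (exists2 H : graph T, subgraph H G & uniform_subdivision_Tomega H) ->
  exists g : T -> nat -> nat, forall R, ray G R ->
    exists n0, forall n, n0 <= n -> forall N,
      exists2 p, N <= p & L (R (n + p)) <= g (R n) p.
Proof.
move=> no_unif.
have [|le [le_trans le_total le_least le_sep]] :=
    @ranking T (fun x Y => forall k, separated G [set k] x Y).
  move=> Y [b0 Yb0]; apply: contrapT => nsep; apply: no_unif.
  have [|ell ellP] := @choice _ _ (fun x k => Y x -> ~ separated G [set k] x Y).
    move=> x; have [Yx|] := pselect (Y x); last by exists 0.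
    apply: contrapT => nex; apply: nsep; exists x => // k.
    by apply: contrapT => ns; apply: nex; exists k.
  have [H [HG _ _ unif]] :=
    @kernel_subdivision T G Y (fun x => [set ell x]) b0 Yb0 ellP.
  by exists H => //; apply: unif => x k k' _ -> ->.
have [g gP] := @choice _ _ _ (fun u => milestone_bound_by_position L le_trans le_total u le_sep).
exists g => R rayR; have [n0 rec] := recurrent_tail le_least R.
exists n0 => n n0n N.
by apply: (gP (R n) (fun i => R (n + i))) => //; [exact: ray_shift|rewrite addn0|exact: rec].
Qed.

(** The counterpart for a single separator: the bound concerns the j-th
milestone, at an unknown position p >= j. *)
Lemma bounds_without_subdivision :
  ~ (exists H : graph T,
      [/\ subgraph H G, countable (vertices H) & subdivision_Tomega H]) ->
  exists g : T -> nat -> nat, forall R, ray G R ->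
    exists n0, forall n, n0 <= n -> forall j,
      exists2 p, j <= p & L (R (n + p)) <= g (R n) j.
Proof.
move=> no_sub.
have [|le [le_trans le_total le_least le_sep]] :=
    @ranking T (fun x Y => separated G setT x Y).
  move=> Y [b0 Yb0]; apply: contrapT => nsep; apply: no_sub.
  have nsepY x : Y x -> ~ separated G setT x Y.
    by move=> Yx sx; apply: nsep; exists x.
  have [H [HG Hc Hs _]] := @kernel_subdivision T G Y (fun=> setT) b0 Yb0 nsepY.
  by exists H.
have [g gP] := @choice _ _ _ (fun u => milestone_bound_by_rank L u le_sep).
exists g => R rayR; have [n0 rec] := recurrent_tail le_least R.
exists n0 => n n0n j.
by apply: (gP (R n) (fun i => R (n + i))) => //; [exact: ray_shift|rewrite addn0|exact: rec].
Qed.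

End Bounds.

Lemma dominating_graph_contains (T : Type) (G : graph T) :
  dominating_graph G ->
  [\/ exists2 H : graph T, subgraph H G & uniform_subdivision_Tomega H,
      exists B : set (nat -> nat), has_card_b B /\
        exists H : (nat -> nat) -> graph T,
          (forall i, B i -> subgraph (H i) G /\ subdivision_Tomega (H i)) /\
          (forall i j, B i -> B j -> i <> j ->
             vertices (H i) `&` vertices (H j) = set0) |
      exists D : set (nat -> nat), has_card_d D /\
        exists R : (nat -> nat) -> nat -> T,
          (forall i, D i -> ray G (R i)) /\
          (forall i j, D i -> D j -> i <> j ->
             range (R i) `&` range (R j) = set0)].
Proof.
move=> [L domL]; apply: contrapT => nor.
have no_unif c := nor (Or31 _ _ c).
have no_b c := nor (Or32 _ _ c).
have no_d c := nor (Or33 _ _ c).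
have [g1 g1P] := bounds_without_uniform L no_unif.
pose Sub (H : graph T) :=
  [/\ subgraph H G, countable (vertices H) & subdivision_Tomega H].
have [M [MS Mdisj Mmax]] := maximal_independent Sub
  (fun H H' => vertices H `&` vertices H' !=set0).
pose U := \bigcup_(H in M) vertices H.
(* Each subdivision in M is countable, so one function per member of M
   suffices; if these were unbounded, M would have at least b members. *)
have [f1 f1P] : exists f1, forall u, U u -> dominates f1 (g1 u).
  have [|gM gMP] := @choice _ _ (fun H h => M H -> forall u, vertices H u -> dominates h (g1 u)).
    move=> H; have [MH|] := pselect (M H); last by exists id.
    by have [_ Hc _] := MS _ MH; have [h hP] := countable_bounded g1 Hc; exists h.
  have [[f1 f1P]|unb] := pselect (bounded_family (gM @` M)).
    exists f1 => u [H MH Hu]; apply: dominates_trans (gMP H MH u Hu).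
    by apply: f1P; exists H.
  have [B Bb] := has_card_b_exists.
  have [s sM sinj] := least_card_index G Bb unb.
  case: no_b; exists B; split=> //; exists s; split=> [i Bi|i j Bi Bj nij].
    by have [] := MS _ (sM i Bi).
  apply/eqP/negPn/negP => /set0P ne.
  by apply: (Mdisj _ _ (sM i Bi) (sM j Bj)) ne => e; apply: nij; exact: sinj.
pose G' := delete_vertices G U.
have G'G : subgraph G' G := delete_vertices_subgraph G U.
have [|g2 g2P] := @bounds_without_subdivision T G' L.
  move=> [H [[HV HE] Hc Hs]].
  have nU v : vertices H v -> ~ U v by move=> /HV[].
  have SH : Sub H by split=> //; split=> [v /HV[]|e /HE[]].
  have nMH : ~ M H.
    by move=> MH; have [[[v Hv] _] _ _] := Hs; apply: (nU v) => //; exists H.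
  have [H' MH' [[v [Hv Hv']]|[v [Hv' Hv]]]] := Mmax _ SH nMH.
    by apply: (nU v) => //; exists H'.
  by apply: (nU v) => //; exists H'.
have [N [NR Ndisj Nmax]] := maximal_independent (ray G')
  (fun R R' => range R `&` range R' !=set0).
have [|gN gNP] := @choice _ _ (fun (R : nat -> T) h => forall n, dominates h (g2 (R n))).
  move=> R; have [h hP] := @countable_bounded _ setT (fun n => g2 (R n)) (countableP _).
  by exists h => n; exact: hP.
(* If the functions gN were dominating, N would have at least d members. *)
have [f2 f2P] : exists f2, forall R, N R -> ~ dominates (gN R) f2.
  have [dom|ndom] := pselect (dominating_family (gN @` N)); last first.
    apply: contrapT => nex; apply: ndom => f2; apply: contrapT => nf2; apply: nex.
    by exists f2 => R NR' dR; apply: nf2; exists (gN R) => //; exists R.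
  have [[R0 rayR0]|noray] := pselect (exists R, ray G R); last first.
    by have [R rayR] := domL id; case: noray; exists R.
  have [D Dd] := has_card_d_exists.
  have [s sN sinj] := least_card_index R0 Dd dom.
  case: no_d; exists D; split=> //; exists s; split=> [i Di|i j Di Dj nij].
    exact: ray_subgraph (NR _ (sN i Di)).
  apply/eqP/negPn/negP => /set0P ne.
  by apply: (Ndisj _ _ (sN i Di) (sN j Dj)) ne => e; apply: nij; exact: sinj.
(* Monotonicity makes F immune to the shift between positions on a ray and
   positions on a tail of it. *)
pose F := monotone_hull (fun n => maxn (f1 n).+1 (f2 n)).
have F1 p n : f1 p < F (n + p).
  apply: leq_trans (monotone_hull_mono _ (leq_addl n p)).
  by apply: leq_trans (monotone_hull_ge _ (leqnn p)); exact: leq_maxl.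
have F2 j p n : j <= p -> f2 j <= F (n + p).
  move=> jp; apply: leq_trans (monotone_hull_mono _ (leq_addl n p)).
  by apply: leq_trans (monotone_hull_ge _ jp); exact: leq_maxr.
have [R rayR /dominatesP[N0 RF]] := domL F.
have [often|] := pselect (forall n, exists2 m, n <= m & U (R m)).
  have [n0 n0P] := g1P R rayR.
  have [m mN0 Um] := often (maxn n0 N0); move: mN0; rewrite geq_max => /andP[n0m N0m].
  have /dominatesP[N1 f1g] := f1P _ Um.
  have [p N1p Lp] := n0P m n0m N1.
  have := RF (m + p); rewrite (leq_trans N0m) ?leq_addr // => /(_ isT) FL.
  have := leq_trans (leq_trans (F1 p m) FL) (leq_trans Lp (f1g p N1p)).
  by rewrite ltnn.
move=> /existsNP[n1 n1P].
have nU n : n1 <= n -> ~ U (R n) by move=> n1n Un; apply: n1P; exists n.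
have rayR1 : ray G' (fun i => R (n1 + i)).
  by apply: ray_delete_vertices; [exact: ray_shift|move=> n; apply: nU; exact: leq_addr].
have [n0 n0P] := g2P _ rayR1.
pose n2 := maxn n0 N0.
have rayR2 : ray G' (fun i => R (n1 + (n2 + i))) := ray_shift n2 rayR1.
have [R' NR' [i [j e]]] : exists2 R', N R' & exists i j, R (n1 + (n2 + i)) = R' j.
  have [NR2|nNR2] := pselect (N (fun i => R (n1 + (n2 + i)))).
    by exists (fun i => R (n1 + (n2 + i))) => //; exists 0, 0.
  have [R' NR' [[v [[i _ ei] [j _ ej]]]|[v [[j _ ej] [i _ ei]]]]] := Nmax _ rayR2 nNR2;
    by exists R' => //; exists i, j; rewrite ei ej.
have /dominatesP[N1 N1P] := gNP R' j.
have [k N1k lt] := not_dominates_often (f2P R' NR') N1.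
have [|p kp Lp] := n0P (n2 + i) _ k.
  by rewrite (leq_trans (leq_maxl n0 N0)) // leq_addr.
have := RF (n1 + (n2 + i + p)).
rewrite (leq_trans (leq_maxr n0 N0)) => [/(_ isT) FL|]; last first.
  by rewrite -/n2 (leq_trans _ (leq_addl _ _)) // -addnA leq_addr.
have gk := N1P k N1k; rewrite -e in gk.
move: FL; rewrite addnA => FL.
have := leq_trans (F2 k p (n1 + (n2 + i)) kp) FL.
rewrite -addnA; move=> /leq_trans/(_ (leq_trans Lp gk)).
by rewrite leqNgt lt.
Qed.

Theorem theorem3p1 (T : Type) (G : graph T) :
  dominating_graph G <->
  [\/ exists2 H : graph T, subgraph H G & uniform_subdivision_Tomega H,
      exists B : set (nat -> nat), has_card_b B /\
        exists H : (nat -> nat) -> graph T,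
          (forall i, B i -> subgraph (H i) G /\ subdivision_Tomega (H i)) /\
          (forall i j, B i -> B j -> i <> j ->
             vertices (H i) `&` vertices (H j) = set0) |
      exists D : set (nat -> nat), has_card_d D /\
        exists R : (nat -> nat) -> nat -> T,
          (forall i, D i -> ray G (R i)) /\
          (forall i j, D i -> D j -> i <> j ->
             range (R i) `&` range (R j) = set0)].
Proof.
split; first exact: dominating_graph_contains.
case=> [[H HG unif]|[B [[unbB _] [H [HG disj]]]]|[D [[domD _] [R [rayR disj]]]]].
- have [L LP] := uniform_dominates unif; exists L => f.
  by have [R rayR RL] := LP f; exists R => //; exact: ray_subgraph rayR.
- exact: disjoint_subdivisions_dominate unbB HG disj.
- exact: disjoint_rays_dominate domD rayR disj.
Qed.
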